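(* Let $n,k\in\mathbb{N}$ and let $B_1,\dots,B_k$ be compact convex subsets of $\mathbb{R}^n$. Define $v:\mathbb{R}_+^k\to\mathbb{R}$ by $v(x)=\left|\sum_{i=1}^k x_iB_i\right|$. Then $v$ is $m$-supermodular for every positive integer $m$.
   Context: $|\cdot|$ denotes $n$-dimensional Lebesgue measure and $\sum x_iB_i$ is the Minkowski sum $\{\sum x_i b_i: b_i\in B_i\}$. For $x,y\in\mathbb{R}_+^k$, $x\vee y$ and $x\wedge y$ denote the componentwise maximum and minimum. A function $f:\mathbb{R}_+^k\to\mathbb{R}$ is called $m$-supermodular if for every $x_0\in\mathbb{R}_+^k$ and every $x_1,\dots,x_m\in\mathbb{R}_+^k$ with mutually disjoint supports (i.e. $x_i\wedge x_j=0$ for all $1\le i<j\le m$) one has $\sum_{I\subset[m]}(-1)^{m-|I|}f\left(x_0\vee\bigvee_{i\in I}x_i\right)\ge 0$, where $[m]=\{1,\dots,m\}$ and the empty join is omitted. *)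

(* Defs.v *)
From HB Require Import structures.
From mathcomp Require Import all_boot all_order all_algebra.
From mathcomp Require Import all_classical all_reals all_analysis.
Set Implicit Arguments. Unset Strict Implicit. Unset Printing Implicit Defensive.
Import Order.TTheory GRing.Theory Num.Theory.
Import numFieldNormedType.Exports.
Local Open Scope classical_set_scope.
Local Open Scope ring_scope.

Definition box (R : realType) (n : nat) (a b : 'rV[R]_n) : set 'rV[R]_n :=
  [set y | forall i, a ord0 i <= y ord0 i <= b ord0 i].

Definition box_vol (R : realType) (n : nat) (a b : 'rV[R]_n) : R :=
  \prod_(i < n) (b ord0 i - a ord0 i).

(** n-dimensional Lebesgue (outer) measure: infimum of total volumes of
    countable covers by closed boxes.  On Lebesgue measurable sets (in
    particular compact sets) this is the Lebesgue measure |.|. *)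
Definition lebesgue_vol (R : realType) (n : nat) (A : set 'rV[R]_n) : \bar R :=
  ereal_inf [set s : \bar R | exists a b : nat -> 'rV[R]_n,
     [/\ forall j i, a j ord0 i <= b j ord0 i,
         A `<=` \bigcup_j box (a j) (b j) &
         s = (\sum_(0 <= j <oo) (box_vol (a j) (b j))%:E)%E]].

Definition minkowski_comb (R : realType) (n k : nat) (x : 'I_k -> R)
    (B : 'I_k -> set 'rV[R]_n) : set 'rV[R]_n :=
  [set y | exists b : 'I_k -> 'rV[R]_n,
     (forall i, B i (b i)) /\ y = \sum_(i < k) x i *: b i].

(** v(x) = | sum_i x_i B_i |  (real valued; finite for compact B_i). *)
Definition mixed_vol_fun (R : realType) (n k : nat) (B : 'I_k -> set 'rV[R]_n)
    (x : 'I_k -> R) : R :=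
  fine (lebesgue_vol (minkowski_comb x B)).

Definition nonneg_vec (R : realType) (k : nat) (x : 'I_k -> R) : Prop :=
  forall l, 0 <= x l.

Definition join_over (R : realType) (k m : nat) (x0 : 'I_k -> R)
    (xs : 'I_m -> 'I_k -> R) (I : {set 'I_m}) : 'I_k -> R :=
  fun l => Num.max (x0 l) (\big[Num.max/0]_(i in I) xs i l).

Definition m_supermodular (R : realType) (k m : nat)
    (f : ('I_k -> R) -> R) : Prop :=
  forall (x0 : 'I_k -> R) (xs : 'I_m -> 'I_k -> R),
    nonneg_vec x0 -> (forall i, nonneg_vec (xs i)) ->
    (forall i j : 'I_m, i != j -> forall l, Num.min (xs i l) (xs j l) = 0) ->
    0 <= \sum_(I : {set 'I_m}) (-1) ^+ (m - #|I|) * f (join_over x0 xs I).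

(* Main.v *)
(** Mixed subdivisions show that the volume of a Minkowski combination of
    polytopes is a polynomial with nonnegative coefficients.  Let the vertices
    [p j] be coloured by the bodies and write the points of [sum_l x_l P_l] as
    [sum_j mu_j p_j], where [mu >= 0] has total mass [x_l] on the colour [l].
    Minimise a generic linear cost [g] over all [mu] representing a given point:
    the minimiser is unique, and whether a weight is minimal depends only on its
    support [S], not on [x].  The points whose minimiser has support [S] form a
    cell, a product of open simplices spanned by independent edge directions;
    passing from [1] to [x] multiplies each edge direction by the [x_l] of its
    colour, so the volume of the cell is a constant times a monomial in [x], and
    the cells partition the polytope.

    For a monomial, the alternating sum over joins of vectors with disjoint
    supports factors as a product of nonnegative differences.

    General convex bodies are approximated by the convex hulls of finite nets,
    with all coefficients enlarged slightly and a small cross-polytope added so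
    that the approximation is from outside and all coefficients are positive;
    outer regularity bounds the error. *)
Require Import Defs.
From HB Require Import structures.
From mathcomp Require Import all_boot all_order all_algebra.
From mathcomp Require Import all_classical all_reals all_analysis.
From mathcomp Require Import ring lra.
Import Order.TTheory GRing.Theory Num.Theory.
Import numFieldNormedType.Exports.
Set Implicit Arguments. Unset Strict Implicit. Unset Printing Implicit Defensive.
Local Open Scope classical_set_scope.
Local Open Scope ring_scope.

(** * The outer measure [lebesgue_vol] *)

Section BoxCovers.
Context {R : realType} {n : nat}.
Implicit Types (A : set 'rV[R]_n) (a b d z : 'rV[R]_n).

Lemma box_vol_ge0 a b : (forall i, a ord0 i <= b ord0 i) -> 0 <= box_vol a b.
Proof. by move=> ab; apply: prodr_ge0 => i _; rewrite subr_ge0. Qed.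

Lemma lebesgue_vol_cover A (a b : nat -> 'rV[R]_n) :
  (forall j i, a j ord0 i <= b j ord0 i) -> A `<=` \bigcup_j box (a j) (b j) ->
  (lebesgue_vol A <= \sum_(0 <= j <oo) (box_vol (a j) (b j))%:E)%E.
Proof. by move=> ab AB; apply: ereal_inf_lbound; exists a, b. Qed.

Lemma lebesgue_vol_ge0 A : (0 <= lebesgue_vol A)%E.
Proof.
apply: le_ereal_inf_tmp => _ [a [b [ab _ ->]]].
by apply: nneseries_ge0 => j _ _; rewrite lee_fin box_vol_ge0.
Qed.

Lemma le_lebesgue_vol : {homo @lebesgue_vol R n : A B / A `<=` B >-> (A <= B)%E}.
Proof.
move=> A B AB; apply: le_ereal_inf_tmp => _ [a [b [ab Bab ->]]].
exact: lebesgue_vol_cover (subset_trans AB Bab).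
Qed.

Lemma lebesgue_vol_approx A (e : R) : 0 < e -> lebesgue_vol A \is a fin_num ->
  exists a b : nat -> 'rV[R]_n,
   [/\ forall j i, a j ord0 i <= b j ord0 i,
     A `<=` \bigcup_j box (a j) (b j) &
     (\sum_(0 <= j <oo) (box_vol (a j) (b j))%:E <= lebesgue_vol A + e%:E)%E].
Proof.
move=> e0 Afin; have [_ [a [b [ab AB ->]]] /ltW le_e] := lb_ereal_inf_adherent e0 Afin.
by exists a, b.
Qed.

(** Near-optimal covers, with error [e / 2 ^ k.+1] for the [k]-th set, are merged into one sequence
    along a bijection of [nat] with [nat * nat]. *)
Lemma lebesgue_vol_sigma_subadditive : sigma_subadditive (@lebesgue_vol R n).
Proof.
move=> F; have [[i ioo]|Foo] := pselect (exists i, lebesgue_vol (F i) = +oo%E).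
  rewrite (eseries_pinfty _ _ ioo) ?leey// => k _.
  by rewrite -ltNye (lt_le_trans _ (lebesgue_vol_ge0 _)).
have Ffin k : lebesgue_vol (F k) \is a fin_num.
  rewrite ge0_fin_numE ?lebesgue_vol_ge0// ltey.
  by apply/eqP => Fk; apply: Foo; exists k.
apply/lee_addgt0Pr => e e0.
apply: le_trans (epsilon_trick xpredT (fun k => lebesgue_vol_ge0 (F k)) (ltW e0)).
have /choice[ab abP] k : exists ab : (nat -> 'rV[R]_n) * (nat -> 'rV[R]_n),
   [/\ forall j i, ab.1 j ord0 i <= ab.2 j ord0 i,
     F k `<=` \bigcup_j box (ab.1 j) (ab.2 j) &
     (\sum_(0 <= j <oo) (box_vol (ab.1 j) (ab.2 j))%:E
       <= lebesgue_vol (F k) + (e / (2 ^ k.+1)%:R)%:E)%E].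
  have e2 : 0 < e / (2 ^ k.+1)%:R by rewrite divr_gt0// ltr0n expn_gt0.
  by have [a [b ?]] := lebesgue_vol_approx e2 (Ffin k); exists (a, b).
have /card_esym/ppcard_eqP[f] := card_nat2.
pose a j := (ab (f j).1).1 (f j).2; pose b j := (ab (f j).1).2 (f j).2.
have abj j i : a j ord0 i <= b j ord0 i by have [/(_ (f j).2 i)] := abP (f j).1.
pose w (p : nat * nat) := (box_vol ((ab p.1).1 p.2) ((ab p.1).2 p.2))%:E.
have w0 p : (0 <= w p)%E.
  by rewrite lee_fin box_vol_ge0// => i; have [/(_ p.2 i)] := abP p.1.
apply: (@le_trans _ _ (\sum_(0 <= j <oo) (box_vol (a j) (b j))%:E)%E).
  apply: lebesgue_vol_cover => // x [k _ Fkx].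
  have [_ /(_ _ Fkx)[j _ xj] _] := abP k.
  by exists (f^-1%FUN (k, j)) => //; rewrite /a /b invK ?inE.
have -> : (\sum_(0 <= j <oo) (box_vol (a j) (b j))%:E)%E =
    \esum_(i in [set: nat]) (w (f i)).
  by rewrite nneseries_esumT// => j; exact: w0.
have -> : \esum_(i in [set: nat]) (w (f i)) = \esum_(p in [set: nat * nat]) w p.
  by apply/esym/reindex_esum; exact: bij.
have -> : [set: nat * nat] = [set: nat] `*`` (fun=> [set: nat]).
  by apply/seteqP; split.
rewrite -(@esum_esum _ _ _ _ _ (fun i j => w (i, j)))//.
rewrite -nneseries_esumT; last by move=> k; exact: esum_ge0.
apply: lee_nneseries => [k _ _|k _]; first exact: esum_ge0.
by rewrite -nneseries_esumT//; have [] := abP k.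
Qed.

(** Affine maps of this diagonal form, with positive [d], send boxes to boxes, so box covers can be
    transported along them. *)
Definition scale_shift d z (y : 'rV[R]_n) : 'rV[R]_n :=
  \row_i (y ord0 i * d ord0 i + z ord0 i).

Lemma le_lebesgue_vol_scale_shift A d z : (forall i, 0 < d ord0 i) ->
  (lebesgue_vol (scale_shift d z @` A)
    <= (\prod_i d ord0 i)%:E * lebesgue_vol A)%E.
Proof.
move=> d0; have D0 : 0 < \prod_i d ord0 i by rewrite prodr_gt0.
rewrite -lee_pdivrMl//; apply: le_ereal_inf_tmp => _ [a [b [ab Aab ->]]].
rewrite lee_pdivrMl// -nneseriesZl; last first.
  by move=> j _; rewrite lee_fin box_vol_ge0.
rewrite (eq_eseriesr (g := fun j =>
    (box_vol (scale_shift d z (a j)) (scale_shift d z (b j)))%:E)); last first.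
  move=> j _; rewrite -EFinM -big_split/=; congr (_%:E); apply: eq_bigr => i _.
  by rewrite !mxE; ring.
apply: lebesgue_vol_cover => [j i|_ [y Ay <-]].
  by rewrite !mxE lerD2r ler_wpM2r// ltW.
have [j _ yj] := Aab _ Ay; exists j => // i; have /andP[yl yr] := yj i.
by rewrite !mxE !lerD2r !ler_wpM2r// ltW.
Qed.

(** The missing inequality is the previous one for the inverse map. *)
Lemma lebesgue_vol_scale_shift A d z : (forall i, 0 < d ord0 i) ->
  lebesgue_vol (scale_shift d z @` A) = ((\prod_i d ord0 i)%:E * lebesgue_vol A)%E.
Proof.
move=> d0; have D0 : 0 < \prod_i d ord0 i by rewrite prodr_gt0.
apply/eqP; rewrite eq_le le_lebesgue_vol_scale_shift//=.
pose d' : 'rV[R]_n := \row_i (d ord0 i)^-1.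
pose z' : 'rV[R]_n := \row_i (- (z ord0 i / d ord0 i)).
have d'0 i : 0 < d' ord0 i by rewrite mxE invr_gt0.
have D'E : \prod_i d' ord0 i = (\prod_i d ord0 i)^-1.
  by rewrite -prodfV; apply: eq_bigr => i _; rewrite mxE.
have := @le_lebesgue_vol_scale_shift (scale_shift d z @` A) d' z' d'0.
rewrite image_comp (_ : _ @` A = A); last first.
  rewrite -[RHS]image_id; apply: eq_imagel => y _ /=.
  by apply/rowP => i; rewrite !mxE mulrDl mulfK ?gt_eqF// addrK.
by rewrite D'E lee_pdivlMl.
Qed.

End BoxCovers.

(** * The outer measure in positive dimension *)

Section LebesgueOuter.
Context {R : realType} {n : nat}.
Notation V := 'rV[R]_n.+1.
Implicit Types A : set V.

(** Fails in dimension 0, where the empty product gives every box volume 1 and [lebesgue_vol] is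
    infinite on every set; hence the measure theory is done in dimension [n.+1]. *)
Lemma box_volxx (a : V) : box_vol a a = 0.
Proof. by rewrite /box_vol big_ord_recl subrr mul0r. Qed.

Lemma lebesgue_vol_box (a b : V) : (forall i, a ord0 i <= b ord0 i) ->
  (lebesgue_vol (box a b) <= (box_vol a b)%:E)%E.
Proof.
move=> ab; pose b' j := if j is 0%N then b else a.
have -> : (box_vol a b)%:E = (\sum_(0 <= j <oo) (box_vol a (b' j))%:E)%E.
  rewrite nneseries_recl//; last first.
    by case=> [|j] _; rewrite lee_fin box_vol_ge0.
  by rewrite eseries_cond/= eseries0 ?adde0// => -[|]//= k _ _; rewrite box_volxx.
by apply: lebesgue_vol_cover => [[|j] i//|y ?]; exists 0%N.
Qed.

Lemma lebesgue_vol0 : lebesgue_vol (set0 : set V) = 0%E.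
Proof.
apply/eqP; rewrite eq_le lebesgue_vol_ge0 andbT -[leRHS]/(0%:E) -(box_volxx 0).
by rewrite (le_trans _ (lebesgue_vol_box _))//; exact: le_lebesgue_vol.
Qed.

HB.instance Definition _ := isOuterMeasure.Build R V (@lebesgue_vol R n.+1)
  lebesgue_vol0 lebesgue_vol_ge0 le_lebesgue_vol lebesgue_vol_sigma_subadditive.

Definition lebesgue_outer : {outer_measure set V -> \bar R} := @lebesgue_vol R n.+1.

End LebesgueOuter.

(** * Half-spaces and dyadic cubes *)

Section HalfSpaces.
Context {R : realType} {n : nat}.
Notation V := 'rV[R]_n.+1.
Notation lam := (@lebesgue_outer R n).
Implicit Types A : set V.

(** The hyperplane cuts each box of a cover into two boxes whose volumes add up, so a cover of [X]
    yields covers of both parts at the same total cost. *)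
Lemma lebesgue_vol_halfspace (i : 'I_n.+1) (c : R) :
  lam.-caratheodory [set y : V | y ord0 i < c].
Proof.
apply: le_caratheodory_measurable => X; set H : set V := [set y | _].
apply: le_ereal_inf_tmp => _ [a [b [ab Xab ->]]].
(* The height [c] clamped to the [i]-th side of the box: a box missed by the hyperplane gets one
   degenerate piece. *)
pose m j := Num.max (a j ord0 i) (Num.min (b j ord0 i) c).
pose b1 j : V := \row_k (if k == i then m j else b j ord0 k).
pose a2 j : V := \row_k (if k == i then m j else a j ord0 k).
have am j : a j ord0 i <= m j by rewrite le_max lexx.
have mb j : m j <= b j ord0 i by rewrite ge_max ab ge_min lexx.
have ab1 j k : a j ord0 k <= b1 j ord0 k by rewrite mxE; case: eqP => [->|].
have a2b j k : a2 j ord0 k <= b j ord0 k by rewrite mxE; case: eqP => [->|].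
rewrite (eq_eseriesr (g := fun j => ((box_vol (a j) (b1 j))%:E +
    (box_vol (a2 j) (b j))%:E)%E)); last first.
  move=> j _; rewrite -EFinD; congr (_%:E).
  rewrite /box_vol (bigD1 i)//= [X in _ = X + _](bigD1 i)//=.
  rewrite [X in _ = _ + X](bigD1 i)//= !mxE eqxx.
  rewrite [in X in _ = X + _](eq_bigr (fun k => b j ord0 k - a j ord0 k)); last first.
    by move=> k /negbTE ki; rewrite mxE ki.
  rewrite [in X in _ = _ + X](eq_bigr (fun k => b j ord0 k - a j ord0 k)); last first.
    by move=> k /negbTE ki; rewrite mxE ki.
  by ring.
rewrite nneseriesD; [|by move=> j _ _; rewrite lee_fin box_vol_ge0..].
apply: leeD; apply: lebesgue_vol_cover => // y [/Xab[j _ yj] Hy]; exists j => // k;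
  have /andP[yl yr] := yj k; rewrite mxE; case: eqP => [ki|_]; rewrite ?yl ?yr ?andbT//.
- by subst k; rewrite le_max le_min yr (ltW Hy) orbT.
- subst k; rewrite ge_max yl ge_min/=.
  by move/negP : Hy; rewrite -leNgt => ->; rewrite orbT.
Qed.

(** Half-open dyadic cubes of side [2 ^- j]; with the floor encoding, the cubes of one level
    partition the space by construction. *)
Definition grid_cube (j : nat) (z : 'rV[int]_n.+1) : set V :=
  [set y | forall i, Num.floor (y ord0 i * 2 ^+ j) = z ord0 i].

Lemma grid_cubeE j z : grid_cube j z = scale_shift (const_mx (2 ^- j))
  (\row_i ((z ord0 i)%:~R * 2 ^- j)) @` grid_cube 0 0.
Proof.
have e0 : 2 ^+ j != 0 :> R by rewrite expf_neq0// pnatr_eq0.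
apply/seteqP; split => [y yz|_ [y y0 <-] i].
- exists (\row_i (y ord0 i * 2 ^+ j - (z ord0 i)%:~R)) => [i|].
  + by rewrite !mxE expr0 mulr1 floorDrz ?rpredN ?intr_int// yz -mulrNz intrKfloor subrr.
  + by apply/rowP => i; rewrite !mxE mulrBl mulfK// addrNK.
- have := y0 i; rewrite !mxE expr0 mulr1 -mulrDl mulfVK// => y00.
  by rewrite floorDrz ?intr_int// y00 add0r intrKfloor.
Qed.
End HalfSpaces.

(** * Measurability of open sets through dyadic cubes *)

Section Grid.
Context {R : realType} {n : nat}.
Notation V := 'rV[R]_n.+1.
Notation lam := (@lebesgue_outer R n).
Notation cube := (@grid_cube R n).

Lemma grid_cube_halfspaces j z : cube j z = \bigcap_(i in [set: 'I_n.+1])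
  ([set y : V | y ord0 i < (z ord0 i + 1)%:~R * 2 ^- j] `&`
   ~` [set y : V | y ord0 i < (z ord0 i)%:~R * 2 ^- j]).
Proof.
have e0 : 0 < 2 ^+ j :> R by rewrite exprn_gt0.
apply/seteqP; split => [y yz i _|y yz i].
  have /eqP := yz i; rewrite floor_eq => /andP[yl yr]; split => /=.
    by rewrite ltr_pdivlMr.
  by apply/negP; rewrite -leNgt ler_pdivrMr.
have [/= yr /negP] := yz i I; rewrite -leNgt => yl.
by apply/eqP; rewrite floor_eq -ler_pdivrMr// yl/= -ltr_pdivlMr.
Qed.

Lemma caratheodory_grid_cube j z : lam.-cara.-measurable (cube j z).
Proof.
rewrite grid_cube_halfspaces.
apply: (@fin_bigcap_measurable _ (caratheodory_type lam)) => // i _.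
apply: measurableI; last apply: measurableC; exact: lebesgue_vol_halfspace.
Qed.

(** The index at the coarse level [k] is determined by the one at level [j]: by [E], it equals [z']
    exactly when the finer floor lies between [z' * s] and [(z' + 1) * s]. *)
Lemma grid_cube_nested j k z z' y : (k <= j)%N -> cube j z y -> cube k z' y ->
  cube j z `<=` cube k z'.
Proof.
move=> /subnK <-; set d := (j - k)%N => yz yz' x xz i.
have e0 : 0 < 2 ^+ d :> R by rewrite exprn_gt0.
pose s : int := 2 ^+ d.
have sE : s%:~R = 2 ^+ d :> R by rewrite rmorphXn.
have E (w : R) : (Num.floor (w * 2 ^+ k) == z' ord0 i) =
    (z' ord0 i * s <= Num.floor (w * 2 ^+ (d + k)) < (z' ord0 i + 1) * s).
  rewrite floor_eq floor_lt_int floor_ge_int !intrM sE exprD.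
  by rewrite mulrA (mulrAC w) ler_pM2r// ltr_pM2r.
by apply/eqP; rewrite E xz -yz -E yz'.
Qed.

Lemma grid_cube_small (U : set V) y : open U -> U y ->
  exists j z, cube j z y /\ cube j z `<=` U.
Proof.
move=> oU Uy; have /nbhs_ballP[e /= e0 yeU] : nbhs y U by exact: open_nbhs_nbhs.
(* [2 ^ j > j > e^-1], so the side of the cubes is below [e]. *)
pose j := (Num.truncn e^-1).+1.
have j2 : 0 < 2 ^+ j :> R by rewrite exprn_gt0.
have je : 2 ^- j < e.
  rewrite invf_plt ?posrE//; apply: lt_le_trans (truncnS_gt _) _.
  by rewrite -natrX ler_nat ltnW// ltn_expl.
exists j, (\row_i Num.floor (y ord0 i * 2 ^+ j)); split => [i|x xy].
  by rewrite mxE.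
apply: yeU; split => // i k; rewrite ord1 /ball/= (lt_trans _ je)//.
have := xy k; rewrite mxE => E.
have /andP[xl xr] := floor_itv (x ord0 k * 2 ^+ j).
have /andP[yl yr] := floor_itv (y ord0 k * 2 ^+ j).
rewrite -[ltRHS]mul1r ltr_pdivlMr// -[X in _ * X]gtr0_norm// -normrM.
rewrite E in xl xr; move: xl xr yl yr; rewrite intrD mulrBl ltr_norml => *.
by lra.
Qed.

(** Take the maximal dyadic cubes contained in [U]. *)
Lemma open_grid_partition (U : set V) : open U -> exists F : nat -> set V,
  [/\ trivIset [set: nat] F, U = \bigcup_k F k &
      forall k, F k = set0 \/ exists j z, F k = cube j z].
Proof.
move=> oU; pose top j z := cube j z `<=` U /\
  forall k z', (k < j)%N -> cube k z' `<=` U -> ~ cube j z `<=` cube k z'.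
pose G (p : nat * 'rV[int]_n.+1) := [set y | cube p.1 p.2 y /\ top p.1 p.2].
have Gsep p q y : G p y -> G q y -> (p.1 <= q.1)%N -> p = q.
  case: p q => [j z] [k z'] [/= yz [zU ztop]] [/= yz' [z'U z'top]].
  rewrite leq_eqVlt => /predU1P[jk|jk].
    by subst k; congr pair; apply/rowP => i; rewrite -yz -yz'.
  by case: (z'top _ _ jk zU); exact: grid_cube_nested (ltnW jk) yz' yz.
have Gdisj p q y : G p y -> G q y -> p = q.
  by move=> Gp Gq; case/orP: (leq_total p.1 q.1) => ?; [|symmetry]; apply: (Gsep _ _ y).
(* Pairs of a level and an index are enumerated by [pickle]; a number that encodes no pair, or a
   cube that is not maximal, contributes the empty set. *)
exists (fun k => oapp G set0 (pickle_inv k)); split.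
- move=> j k _ _ [y []].
  have := @pickle_invK (nat * 'rV[int]_n.+1)%type k.
  have := @pickle_invK (nat * 'rV[int]_n.+1)%type j.
  case: (pickle_inv j) => [p|]//= jE; case: (pickle_inv k) => [q|]//= kE.
  by move=> Gp Gq; rewrite -jE -kE; congr pickle; exact: Gdisj Gp Gq.
- apply/seteqP; split => [y Uy|y [k _]]; last first.
    by case: pickle_inv => //= p [yp [pU _]]; exact: pU.
  have ex : exists j, `[< exists z, cube j z y /\ cube j z `<=` U >].
    have [j [z zP]] := grid_cube_small oU Uy.
    by exists j; apply/asboolP; exists z.
  have [j /asboolP[z [yz zU]] jmin] := ex_minnP ex.
  exists (pickle (j, z)) => //; rewrite pickleK_inv/=; split => //; split => // k z' kj z'U zz'.
  suff /jmin : `[< exists z, cube k z y /\ cube k z `<=` U >] by rewrite leqNgt kj.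
  by apply/asboolP; exists z'; split => //; exact: zz'.
- move=> k; case: pickle_inv => [[j z]|]; last by left.
  have [t|t] := pselect (top j z).
    by right; exists j, z; apply/seteqP; split => [y []|y ?].
  by left; apply/seteqP; split => [y []|].
Qed.

Lemma open_caratheodory (U : set V) : open U -> lam.-cara.-measurable U.
Proof.
move=> /open_grid_partition[F [_ -> Fcube]].
apply: bigcup_measurable => k _; case: (Fcube k) => [->|[j [z ->]]].
  exact: measurable0.
exact: caratheodory_grid_cube.
Qed.

End Grid.

(** * Continuity of linear maps and outer regularity *)

Lemma lincomb_continuous {R : realType} {N n : nat} (p : 'I_N -> 'rV[R]_n) :
  continuous (fun mu : 'rV[R]_N => \sum_j mu ord0 j *: p j).
Proof.
apply: (continuous_big add_continuous) => j _ mu.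
have mu_j := @coord_continuous R 1 N ord0 j mu.
exact: (@cvgZr_tmp R 'rV[R]_n _ _ _ _ _ (p j) mu_j).
Qed.

Lemma mulmx_continuous {R : realType} {m n : nat} (G : 'M[R]_(m, n)) :
  continuous (fun y : 'rV[R]_m => y *m G).
Proof.
rewrite (_ : (fun y : 'rV[R]_m => _) = fun y => \sum_j y ord0 j *: row j G).
  exact: lincomb_continuous.
by apply/funext => y; rewrite mulmx_sum_row.
Qed.

Section Regularity.
Context {R : realType} {n : nat}.
Notation V := 'rV[R]_n.+1.
Implicit Types A : set V.

Lemma lebesgue_vol_bounded_fin A (M : R) :
  (forall y, A y -> forall i, `|y ord0 i| <= M) -> lebesgue_vol A \is a fin_num.
Proof.
move=> AM; rewrite ge0_fin_numE ?lebesgue_vol_ge0//.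
have [->|/set0P[y0 Ay0]] := eqVneq A set0; first by rewrite lebesgue_vol0 ltry.
have M0 : 0 <= M := le_trans (normr_ge0 _) (AM _ Ay0 ord0).
apply: (@le_lt_trans _ _ (lebesgue_vol (box (const_mx (- M)) (const_mx M) : set V))).
  by apply: le_lebesgue_vol => y /AM yM i; rewrite !mxE -ler_norml.
apply: (le_lt_trans (lebesgue_vol_box _)); last by rewrite ltry.
by move=> i; rewrite !mxE; lra.
Qed.

Lemma box_vol_enlarge (a b : V) (e : R) : 0 < e -> exists2 t, 0 < t &
  box_vol (a - const_mx t) (b + const_mx t) <= box_vol a b + e.
Proof.
move=> e0.
pose f (t : R) := \prod_(i < n.+1) (b ord0 i - a ord0 i + t *+ 2).
have f0 : f 0 = box_vol a b.
  by apply: eq_bigr => i _; rewrite mul0rn addr0.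
have cf : f t @[t --> 0] --> f 0.
  apply: (cvg_big mul_continuous) => i _.
  apply: cvgD; first exact: cvg_cst.
  exact: (cvgMn (f := id)).
have fe : f 0 < box_vol a b + e by rewrite f0 ltrDl.
have /filter_ex[t [t0 fte]] : \forall t \near 0^'+, 0 < t /\ f t < box_vol a b + e.
  near=> t; split; first by near: t; exact: nbhs_right_gt.
  by near: t; exact: (cvgr_lt (f 0) (cvg_at_right_filter cf)).
exists t => //; apply: le_trans (ltW fte); rewrite le_eqVlt; apply/orP; left.
by apply/eqP/eq_bigr => i _; rewrite !mxE mulr2n; ring.
Unshelve. all: by end_near. Qed.

(** Outer regularity: half of [e] pays for a near-optimal box cover, the other half for enlarging
    its [j]-th box to an open neighbourhood, at cost [e / 2 / 2 ^ j.+1]. *)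
Lemma lebesgue_vol_open_cover A (e : R) : 0 < e ->
  exists U : set V, [/\ open U, A `<=` U & (lebesgue_vol U <= lebesgue_vol A + e%:E)%E].
Proof.
move=> e0; have [Ay|Afin] := eqVneq (lebesgue_vol A) +oo%E.
  by exists setT; split; [exact: openT|by []|rewrite Ay addye// leey].
have {}Afin : lebesgue_vol A \is a fin_num.
  by rewrite ge0_fin_numE ?lebesgue_vol_ge0// ltey.
have e20 : 0 < e / 2 by rewrite divr_gt0.
have [a [b [ab AB sumab]]] := lebesgue_vol_approx e20 Afin.
have /choice[t tP] j : exists t : R, 0 < t /\
    box_vol (a j - const_mx t) (b j + const_mx t)
      <= box_vol (a j) (b j) + e / 2 / (2 ^ j.+1)%:R.
  have /(box_vol_enlarge (a j) (b j))[s s0 sP] : 0 < e / 2 / (2 ^ j.+1)%:R.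
    by rewrite divr_gt0// ltr0n expn_gt0.
  by exists s.
pose U := \bigcup_j \bigcup_(y in box (a j) (b j)) ball y (t j).
exists U; split.
- by apply: bigcup_open => j _; apply: bigcup_open => y _; exact: ball_open.
- move=> y /AB[j _ yj]; exists j => //; exists y => //; apply: ballxx.
  by have [] := tP j.
- apply: (@le_trans _ _ (\sum_(0 <= j <oo)
      (box_vol (a j - const_mx (t j)) (b j + const_mx (t j)))%:E)%E).
    apply: lebesgue_vol_cover => [j i|y [j _ [x xab [_ /(_ ord0) xy]]]].
      by have [t0 _] := tP j; rewrite !mxE; have := ab j i; lra.
    exists j => // i; have /andP[xa xb] := xab i.
    have := xy i; rewrite /ball/= ltr_distl !mxE => /andP[? ?].
    by apply/andP; split; lra.
  apply: (@le_trans _ _ (\sum_(0 <= j <oo)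
      ((box_vol (a j) (b j))%:E + (e / 2 / (2 ^ j.+1)%:R)%:E))%E).
    apply: lee_nneseries => [j _ _|j _].
      rewrite lee_fin box_vol_ge0// => i; have [t0 _] := tP j.
      by rewrite !mxE; have := ab j i; lra.
    by rewrite -EFinD lee_fin; have [] := tP j.
  apply: le_trans (epsilon_trick _ _ (ltW e20)) _.
    by move=> j; rewrite lee_fin box_vol_ge0.
  apply: (le_trans (leeD2r _ sumab)).
  by rewrite -addeA -EFinD -splitr.
Qed.

End Regularity.

(** * Linear images *)

Section LinearImage.
Context {R : realType} {n : nat}.
Notation V := 'rV[R]_n.+1.
Notation lam := (@lebesgue_outer R n).
Notation cube := (@grid_cube R n).
Implicit Types (A : set V) (G : 'M[R]_n.+1).

Lemma scale_shift_const (d : R) (z y : V) : scale_shift (const_mx d) z y = d *: y + z.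
Proof. by apply/rowP => i; rewrite !mxE mulrC. Qed.

Lemma lebesgue_vol_translate A (z : V) :
  lebesgue_vol ((fun y => y + z) @` A) = lebesgue_vol A.
Proof.
have := @lebesgue_vol_scale_shift _ _ A (const_mx 1) z.
rewrite (_ : scale_shift _ _ = fun y => y + z); last first.
  by apply/funext => y; rewrite scale_shift_const scale1r.
rewrite big1 ?mul1e//; last by move=> i _; rewrite mxE.
by apply => i; rewrite mxE.
Qed.

(** The cube is a homothetic copy of the unit cube, and the homothety commutes with [G] up to a
    translation. *)
Lemma lebesgue_vol_grid_cube_mulmx G j z :
  lebesgue_vol (mulmxr G @` cube j z) =
  ((\prod_(i < n.+1) 2 ^- j)%:E * lebesgue_vol (mulmxr G @` cube 0 0))%E.
Proof.
set d : R := 2 ^- j; rewrite grid_cubeE -/d; set s := \row_i _.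
have -> : mulmxr G @` (scale_shift (const_mx d) s @` cube 0 0) =
    scale_shift (const_mx d) (s *m G) @` (mulmxr G @` cube 0 0).
  rewrite !image_comp; apply: eq_imagel => y _ /=.
  by rewrite !scale_shift_const mulmxDl scalemxAl.
rewrite lebesgue_vol_scale_shift; last first.
  by move=> i; rewrite mxE invr_gt0 exprn_gt0.
by congr (_%:E * _)%E; apply: eq_bigr => i _; rewrite mxE.
Qed.

Lemma grid_cube00_bounded y : cube 0 0 y -> forall i, `|y ord0 i| <= 1.
Proof.
move=> y0 i; have /eqP := y0 i; rewrite expr0 mulr1 mxE floor_eq add0r.
by move=> /andP[yl yr]; rewrite ger0_norm// ltW.
Qed.

Lemma lebesgue_vol_cube_mulmx_fin G : lebesgue_vol (mulmxr G @` cube 0 0) \is a fin_num.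
Proof.
apply: (@lebesgue_vol_bounded_fin _ _ _ (\sum_i \sum_j `|G i j|)).
move=> _ [y y0 <-] i; rewrite mxE (le_trans (ler_norm_sum _ _ _))//.
apply: ler_sum => k _; rewrite (bigD1 i)//= normrM.
rewrite (@le_trans _ _ `|G k i|) ?lerDl ?sumr_ge0//.
by rewrite ler_piMl// grid_cube00_bounded.
Qed.

(** All grid cubes are homothetic, so one constant works for them; the value of
    [lebesgue_vol] on a cube is never needed. *)
Lemma lebesgue_vol_grid_cube_scale G : exists2 c : R, 0 <= c & forall j z,
  lebesgue_vol (mulmxr G @` cube j z) = (c%:E * lebesgue_vol (cube j z))%E.
Proof.
have cube1 j z : cube j z = mulmxr 1%:M @` cube j z.
  by rewrite -[LHS]image_id; apply: eq_imagel => y _ /=; rewrite mulmx1.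
pose q := lebesgue_vol (cube 0 0).
have qfin : q \is a fin_num by rewrite /q cube1 lebesgue_vol_cube_mulmx_fin.
(* A null unit cube would make every set null, since grid cubes cover the space, and any constant
   would do. Otherwise the constant is the ratio for the unit cube. *)
have [q0|q0] := eqVneq q 0%E.
  have lam0 A : lebesgue_vol A = 0%E.
    apply/eqP; rewrite eq_le lebesgue_vol_ge0 andbT.
    have [F [_ FT Fcube]] := open_grid_partition (@openT V).
    apply: le_trans (le_lebesgue_vol (@subsetT _ A)) _; rewrite FT.
    apply: le_trans (lebesgue_vol_sigma_subadditive _) _.
    rewrite eseries0// => k _ _; case: (Fcube k) => [->|[j [z ->]]].
      exact: lebesgue_vol0.
    by rewrite cube1 lebesgue_vol_grid_cube_mulmx -cube1 -/q q0 mule0.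
  by exists 0 => // j z; rewrite !lam0 mule0.
exists (fine (lebesgue_vol (mulmxr G @` cube 0 0)) / fine q).
  by rewrite divr_ge0// fine_ge0// lebesgue_vol_ge0.
move=> j z; rewrite lebesgue_vol_grid_cube_mulmx [in RHS](cube1 j z).
rewrite (lebesgue_vol_grid_cube_mulmx 1%:M) -cube1 -/q.
move: q0; rewrite -fine_eq0// => q0.
have [r ->] : exists r, lebesgue_vol (mulmxr G @` cube 0 0) = r%:E.
  exists (fine (lebesgue_vol (mulmxr G @` cube 0 0))).
  by rewrite fineK// lebesgue_vol_cube_mulmx_fin.
have [s qs] : exists s, q = s%:E by exists (fine q); rewrite fineK.
by rewrite qs/= in q0 *; rewrite -!EFinM; congr (_%:E); field.
Qed.

Lemma image_mulmxr_preimage G A : G \in unitmx -> mulmxr G @` A = mulmxr (invmx G) @^-1` A.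
Proof.
move=> Gu; apply/seteqP; split => [_ [y Ay <-]|y Ay] /=; first by rewrite mulmxK.
by exists (y *m invmx G) => //=; rewrite mulmxKV.
Qed.

Lemma image_mulmxrK G A : G \in unitmx -> mulmxr (invmx G) @` (mulmxr G @` A) = A.
Proof.
move=> Gu; rewrite image_comp -[RHS]image_id; apply: eq_imagel => y _ /=.
by rewrite mulmxK.
Qed.

Lemma open_mulmxr G A : G \in unitmx -> open A -> open (mulmxr G @` A).
Proof.
move=> Gu oA; rewrite image_mulmxr_preimage//.
by move: A oA; apply/continuousP; exact: mulmx_continuous.
Qed.

Lemma caratheodory_grid_cube_mulmxr G j z : G \in unitmx ->
  lam.-cara.-measurable (mulmxr G @` cube j z).
Proof.
move=> Gu.
have H i a : lam.-cara.-measurable (mulmxr (invmx G) @^-1` [set y : V | y ord0 i < a]).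
  rewrite -image_mulmxr_preimage//; apply/open_caratheodory/open_mulmxr => //.
  exact: (open_comp (fun y _ => @coord_continuous R 1 n.+1 ord0 i y) (@open_lt _ a)).
rewrite image_mulmxr_preimage// grid_cube_halfspaces preimage_bigcap.
apply: (@fin_bigcap_measurable _ (caratheodory_type lam)) => // i _.
by apply: measurableI; [exact: H | apply: measurableC; exact: H].
Qed.

(** An open set is a disjoint union of grid cubes and its image one of their images, all with the
    same constant [c]. Outer regularity extends this to arbitrary sets, applied to [A] for one
    inequality and to its image for the other. *)
Lemma lebesgue_vol_mulmxr G : G \in unitmx -> exists2 c : R, 0 <= c &
  forall A, lebesgue_vol (mulmxr G @` A) = (c%:E * lebesgue_vol A)%E.
Proof.
move=> Gu; have [c c0 cE] := lebesgue_vol_grid_cube_scale G; exists c => //.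
have open_scale (U : set V) : open U ->
    lebesgue_vol (mulmxr G @` U) = (c%:E * lebesgue_vol U)%E.
  move=> /open_grid_partition[F [tF -> Fcube]].
  rewrite image_bigcup.
  have mF k : lam.-cara.-measurable (F k).
    case: (Fcube k) => [->|[j [z ->]]]; first exact: measurable0.
    exact: caratheodory_grid_cube.
  have mGF k : lam.-cara.-measurable (mulmxr G @` F k).
    case: (Fcube k) => [->|[j [z ->]]]; first by rewrite image_set0; exact: measurable0.
    exact: caratheodory_grid_cube_mulmxr.
  have tGF : trivIset [set: nat] (fun k => mulmxr G @` F k).
    move=> j k _ _ [_ [[x Fx <-] [y Fy]]] /= /(can_inj (mulmxK Gu)) yx.
    by apply: tF => //; exists x; split => //; rewrite -yx.
  have /= -> := @measure_semi_bigcup _ _ (caratheodory_type lam) lam _ mGF tGF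
    (bigcup_measurable (fun k _ => mGF k)).
  have /= -> := @measure_semi_bigcup _ _ (caratheodory_type lam) lam _ mF tF
    (bigcup_measurable (fun k _ => mF k)).
  rewrite -nneseriesZl; last by move=> *; exact: lebesgue_vol_ge0.
  apply: eq_eseriesr => k _; case: (Fcube k) => [->|[j [z ->]]]; last exact: cE.
  by rewrite image_set0 [lam _]lebesgue_vol0 mule0.
move=> A; apply/eqP; rewrite eq_le; apply/andP; split.
  apply/lee_addgt0Pr => e e0; have c1 : 0 < c + 1 by rewrite ltr_wpDl.
  have [U [oU AU leU]] := lebesgue_vol_open_cover A (divr_gt0 e0 c1).
  apply: (@le_trans _ _ (lebesgue_vol (mulmxr G @` U))).
    by apply: le_lebesgue_vol; exact: image_subset.
  rewrite open_scale//.
  apply: (@le_trans _ _ (c%:E * (lebesgue_vol A + (e / (c + 1))%:E))%E).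
    by rewrite lee_wpmul2l// lee_fin.
  rewrite ge0_muleDr ?lebesgue_vol_ge0 ?lee_fin ?divr_ge0 ?(ltW e0) ?(ltW c1)//.
  by rewrite leeD2l// lee_fin mulrCA ler_piMr ?(ltW e0)// ler_pdivrMr// mul1r lerDl.
apply/lee_addgt0Pr => e e0.
have [W [oW AW leW]] := lebesgue_vol_open_cover (mulmxr G @` A) e0.
apply: le_trans leW; have Giu : invmx G \in unitmx by rewrite unitmx_inv.
rewrite -(image_mulmxrK W Giu) invmxK open_scale; last exact: open_mulmxr.
apply: lee_wpmul2l; first by rewrite lee_fin.
by rewrite -{1}(image_mulmxrK A Gu); apply: le_lebesgue_vol; exact: image_subset.
Qed.

(** The rows of [G] are eigenvectors with eigenvalues [d]. The unknown constant of [G] cancels,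
    since [A] and its image are both [G]-images; no determinant enters. *)
Lemma lebesgue_vol_conj_diag G (d : V) A : G \in unitmx -> (forall i, 0 < d ord0 i) ->
  lebesgue_vol (mulmxr (invmx G *m diag_mx d *m G) @` A) =
  ((\prod_i d ord0 i)%:E * lebesgue_vol A)%E.
Proof.
move=> Gu d0; have [c c0 cE] := lebesgue_vol_mulmxr Gu.
set A' := mulmxr (invmx G) @` A.
have AE : lebesgue_vol A = (c%:E * lebesgue_vol A')%E.
  have Giu : invmx G \in unitmx by rewrite unitmx_inv.
  by rewrite -cE -{1}(image_mulmxrK A Giu) invmxK.
have -> : mulmxr (invmx G *m diag_mx d *m G) @` A =
    mulmxr G @` (scale_shift d 0 @` A').
  rewrite !image_comp; apply: eq_imagel => y _ /=; rewrite !mulmxA; congr (_ *m G).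
  by apply/rowP => i; rewrite mul_mx_diag !mxE addr0.
by rewrite cE lebesgue_vol_scale_shift// AE muleCA.
Qed.
End LinearImage.

(** * Generic mixed subdivisions of coloured polytopes *)

(** Among [size q] distinct naturals at least one is not a root. *)
Lemma poly_nonroot {R : numDomainType} (q : {poly R}) : q != 0 -> exists a, ~~ root q a.
Proof.
move=> q0; pose rs : seq R := [seq k%:R | k <- iota 0 (size q)].
have urs : uniq rs by rewrite map_inj_uniq ?iota_uniq//; exact: mulrIn (oner_neq0 _).
have [/(max_poly_roots q0)/(_ urs)|/allPn[a _ ra]] := boolP (all (root q) rs).
  by rewrite size_map size_iota ltnn.
by exists a.
Qed.

Section ColouredPolytopes.
Context {R : realType} {n N : nat} {L : finType}.
Notation V := 'rV[R]_n.+1.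
Notation W := 'rV[R]_N.
Variables (c : 'I_N -> L) (p : 'I_N -> V).
Implicit Types (x : L -> R) (mu nu u g : W) (S : {set 'I_N}).

Definition colour_sum mu l : R := \sum_(j | c j == l) mu ord0 j.
Definition bary mu : V := \sum_j mu ord0 j *: p j.
Definition wdot g mu : R := \sum_j g ord0 j * mu ord0 j.
Definition wsupp mu : {set 'I_N} := [set j | mu ord0 j != 0].

Definition feas x mu := (forall j, 0 <= mu ord0 j) /\ forall l, colour_sum mu l = x l.
(** The directions of motion of a weight that change neither the masses of the colours nor the
    represented point. *)
Definition circ u := (forall l, colour_sum u l = 0) /\ bary u = 0.
(** Equivalently: choosing a base point in each colour class of [S], the edges
    from the base points are jointly linearly independent. *)
Definition jindep S := forall u, circ u -> wsupp u \subset S -> u = 0.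

(** No direction of motion that is feasible from a weight with support [S]
    lowers the cost: a condition that does not involve the masses [x]. *)
Definition good g S :=
  forall u, circ u -> (forall j, j \notin S -> 0 <= u ord0 j) -> 0 <= wdot g u.
Definition optimal g x mu := feas x mu /\
  forall nu, feas x nu -> bary nu = bary mu -> wdot g mu <= wdot g nu.
(** Genericity rules out ties: on an optimal support carrying a nonzero circulation, the minimiser
    could otherwise move at constant cost. *)
Definition generic g := forall S, (forall u, circ u -> wsupp u \subset S -> wdot g u = 0) ->
  jindep S.

Lemma colour_sumD a u v l :
  colour_sum (u + a *: v) l = colour_sum u l + a * colour_sum v l.
Proof. by rewrite mulr_sumr -big_split/=; apply: eq_bigr => j _; rewrite !mxE. Qed.

Lemma baryD a u v : bary (u + a *: v) = bary u + a *: bary v.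
Proof.
rewrite scaler_sumr -big_split/=; apply: eq_bigr => j _.
by rewrite !mxE scalerDl scalerA.
Qed.

Lemma wdotD g a u v : wdot g (u + a *: v) = wdot g u + a * wdot g v.
Proof.
by rewrite mulr_sumr -big_split/=; apply: eq_bigr => j _; rewrite !mxE; ring.
Qed.

Lemma wsupp_sub0 u S : wsupp u \subset S <-> forall j, j \notin S -> u ord0 j = 0.
Proof.
split => [/fintype.subsetP uS j jS|uS]; last first.
  by apply/fintype.subsetP => j; rewrite inE; apply: contraR => /uS ->.
by apply/eqP; apply: contraNT jS => uj; apply: uS; rewrite inE.
Qed.

Lemma wsuppN0 mu j : (j \notin wsupp mu) = (mu ord0 j == 0).
Proof. by rewrite inE negbK. Qed.

Lemma circB x mu nu : feas x mu -> feas x nu -> bary mu = bary nu ->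
  circ (mu + (-1) *: nu).
Proof.
move=> [_ cmu] [_ cnu] mn; split => [l|].
  by rewrite colour_sumD cmu cnu; ring.
by rewrite baryD mn scaleN1r subrr.
Qed.

(** The cost is a vector of powers [a ^+ j]: its product with a fixed nonzero circulation is the
    value at [a] of a nonzero polynomial. One circulation per dependent [S] suffices, so [a] has to
    avoid the roots of finitely many polynomials. *)
Lemma generic_exists : exists g, generic g.
Proof.
have /choice[w wP] S : exists u : W, ~ jindep S -> [/\ circ u, wsupp u \subset S & u != 0].
  have [iS|niS] := pselect (jindep S); first by exists 0.
  have [u uP] : exists u : W, ~ (circ u -> wsupp u \subset S -> u = 0).
    by apply/not_existsP => H; apply: niS => u; exact: contrapT (H u).
  exists u => _; split.
  - by apply: contrapT => h; apply: uP => /h.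
  - by apply: contrapT => h; apply: uP => _ /h.
  - by apply/eqP => u0; apply: uP.
pose P S : {poly R} := if `[< jindep S >] then 1 else rVpoly (w S).
have PS0 S : P S != 0.
  rewrite /P; case: asboolP => [_|/wP[_ _ wS0]]; first exact: oner_neq0.
  by apply: contraNneq wS0 => wS0; rewrite -[w S]rVpolyK wS0 linear0.
have /poly_nonroot[a aP] : \prod_S P S != 0 by apply/prodf_neq0 => S _; exact: PS0.
pose g : W := \row_j a ^+ j; exists g => S gS; apply: contrapT => niS.
have [cS sS _] := wP S niS; have /eqP := gS _ cS sS; apply/negP.
move: aP; rewrite /root horner_prod => /prodf_neq0/(_ S isT).
rewrite /P asboolF// (horner_coef_wide _ (size_poly _ _)).
rewrite (_ : wdot _ _ = \sum_(i < N) (rVpoly (w S))`_i * a ^+ i)//.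
by apply: eq_bigr => j _; rewrite coef_rVpoly_ord mxE mulrC.
Qed.

(** A circulation supported in [S] and its opposite both meet the condition in [good], so its cost
    is zero. *)
Lemma good_jindep g S : generic g -> good g S -> jindep S.
Proof.
move=> gg gS; apply: gg => u [cu bu] /wsupp_sub0 uS; apply/eqP.
have cNu : circ (0 + (-1) *: u).
  split=> [l|]; first by rewrite colour_sumD cu mulr0 addr0 /colour_sum big1// => j _; rewrite mxE.
  by rewrite baryD bu scaler0 addr0 /bary big1// => j _; rewrite mxE scale0r.
have g1 : 0 <= wdot g u by apply: gS => // j /uS ->.
have g2 : 0 <= wdot g (0 + (-1) *: u).
  by apply: gS => // j /uS uj; rewrite !mxE uj mulr0 addr0.
move: g2; rewrite wdotD {1}/wdot big1 => [|j _]; last by rewrite mxE mulr0.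
by rewrite eq_le g1 andbT; lra.
Qed.

Lemma good_optimal g x mu : feas x mu -> good g (wsupp mu) -> optimal g x mu.
Proof.
move=> fmu gmu; split => // nu fnu bnu.
have := gmu _ (circB fnu fmu bnu); rewrite wdotD mulN1r subr_ge0; apply => j.
by rewrite wsuppN0 => /eqP mu0; rewrite !mxE mu0 mulr0 addr0; case: fnu.
Qed.

(** A short step from [mu] along [u] stays feasible, as [mu] is positive on its support and [u]
    nonnegative off it. With [good_optimal], optimality of a feasible weight depends on its support
    alone. *)
Lemma optimal_good g x mu : optimal g x mu -> good g (wsupp mu).
Proof.
move=> [[mu0 cmu] omu] u [cu bu] u0.
(* [s] exceeds each ratio of [|u_j|] to [mu_j], so a step of length [s^-1] keeps the weights
   nonnegative; where [mu_j] is 0 the quotient is 0 by convention. *)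
pose s := 1 + \sum_j `|u ord0 j| / mu ord0 j.
have t0 j : 0 <= `|u ord0 j| / mu ord0 j by rewrite divr_ge0.
have s0 : 0 < s by rewrite ltr_pwDl// sumr_ge0.
suff : wdot g mu <= wdot g (mu + s^-1 *: u) by rewrite wdotD lerDl pmulr_rge0 ?invr_gt0.
apply: omu; last by rewrite baryD bu scaler0 addr0.
split => [j|l]; last by rewrite colour_sumD cu mulr0 addr0.
rewrite !mxE; have [jmu|] := boolP (j \in wsupp mu); last first.
  by move=> /u0 uj; rewrite addr_ge0// mulr_ge0// invr_ge0 ltW.
have muj : 0 < mu ord0 j by rewrite lt_neqAle mu0 eq_sym andbT; rewrite inE in jmu.
have : `|u ord0 j| <= s * mu ord0 j.
  rewrite -ler_pdivrMr// /s (bigD1 j)//= addrCA lerDl addr_ge0//.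
  by apply: sumr_ge0 => k _; exact: t0.
by rewrite ler_norml -lerBlDl sub0r ler_pdivlMl// mulrN => /andP[].
Qed.

Lemma feas_compact x S : compact [set mu : W | feas x mu /\ wsupp mu \subset S].
Proof.
pose X j := if j \in S then x (c j) else 0.
pose T := [set mu : W | forall j, `[0, X j]%classic (mu ord0 j)].
have cT : compact T.
  by apply: (@rV_compact _ _ (fun j => `[0, X j]%classic)) => j; exact: segment_compact.
have clC l : closed [set mu : W | colour_sum mu l = x l].
  have cl : continuous (colour_sum^~ l).
    by apply: (continuous_big add_continuous) => j _; exact: coord_continuous.
  exact: (closed_comp (fun mu _ => cl mu) (@closed_eq _ (x l))).
suff -> : [set mu : W | feas x mu /\ wsupp mu \subset S] =
    T `&` \bigcap_(l in [set: L]) [set mu : W | colour_sum mu l = x l].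
  by apply: compact_closedI => //; exact: closed_bigI.
apply/seteqP; split => [mu [[mu0 cmu] /wsupp_sub0 muS]|mu [Tmu Cmu]].
  split => [j|l _]; last exact: cmu.
  rewrite /= in_itv/= mu0/= /X; case: ifPn => [jS|/muS->//].
  by rewrite -cmu /colour_sum (bigD1 j)//= lerDl sumr_ge0.
split.
  split=> [j|l]; last exact: Cmu.
  by have := Tmu j; rewrite /= in_itv/= => /andP[].
apply/wsupp_sub0 => j jS; have := Tmu j; rewrite /= in_itv/= /X (negbTE jS).
by move=> H; apply/eqP; rewrite eq_le andbC.
Qed.

Lemma optimal_exists g x mu : feas x mu ->
  exists nu, [/\ optimal g x nu & bary nu = bary mu].
Proof.
move=> fmu; pose F := [set nu : W | feas x nu /\ wsupp nu \subset [set: 'I_N]%SET] `&`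
  [set nu | bary nu = bary mu].
have cF : compact F.
  apply: compact_closedI; first exact: feas_compact.
  have cb : continuous bary by exact: lincomb_continuous.
  have c1 : closed [set bary mu].
    by apply: compact_closed; [exact: norm_hausdorff|exact: compact_set1].
  exact: (closed_comp (fun nu _ => cb nu) c1).
have F0 : F !=set0 by exists mu; split => //; split => //; exact: finset.subsetT.
have cg : {within F, continuous (wdot g)}.
  apply: continuous_subspaceT; apply: (continuous_big add_continuous) => j _ nu.
  have nu_j := @coord_continuous R 1 N ord0 j nu.
  exact: (@cvgM R _ _ _ (cst (g ord0 j)) _ _ _ (cvg_cst _) nu_j).
have [nu] := compact_EVT_min F0 cF cg.
rewrite inE => -[[fnu _] bnu] numin; exists nu; split => //; split => // k fk bk.
apply: numin; rewrite inE; split; last by rewrite /= bk.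
by split => //; exact: finset.subsetT.
Qed.
End ColouredPolytopes.

(** * The cells: covering, disjointness and measurability *)

Section Cells.
Context {R : realType} {n N : nat} {L : finType}.
Notation V := 'rV[R]_n.+1.
Notation W := 'rV[R]_N.
Notation lam := (@lebesgue_outer R n).
Variables (c : 'I_N -> L) (p : 'I_N -> V).
Implicit Types (x : L -> R) (mu nu u g : W) (S : {set 'I_N}).

Notation feas := (feas c).
Notation bary := (bary p).
Notation jindep := (jindep c p).
Notation good := (good c p).

Definition polytope x : set V := bary @` feas x.
(** The compact counterpart of [cell], through which cells are shown to be measurable. *)
Definition face S x : set V := bary @` [set mu | feas x mu /\ wsupp mu \subset S].
Definition cell S x : set V := bary @` [set mu | feas x mu /\ wsupp mu = S].

Lemma polytope_cells g x : polytope x = \bigcup_(S in good g) cell S x.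
Proof.
apply/seteqP; split => [_ [mu fmu <-]|_ [S _ [mu [fmu _] <-]]]; last by exists mu.
have [nu [onu <-]] := optimal_exists p g fmu.
by exists (wsupp nu); [exact: optimal_good onu|exists nu => //; case: onu].
Qed.

(** The midpoint of two optimal weights of one point is optimal and its support contains both
    supports; being good, this support carries no nonzero circulation, so the two weights agree. *)
Lemma trivIset_cells g x : generic c p g -> trivIset (good g) (fun S => cell S x).
Proof.
move=> gg S T gmu gnu [_ [[mu [fmu mS] <-] [nu [fnu nT] nm]]]; subst S T.
have omu := good_optimal fmu gmu; have onu := good_optimal fnu gnu.
suff -> : mu = nu by [].
have muE : wdot g mu = wdot g nu.
  by apply/eqP; rewrite eq_le omu.2// onu.2.
pose h : W := mu + 2^-1 *: (nu + (-1) *: mu).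
have hE j : h ord0 j = 2^-1 * mu ord0 j + 2^-1 * nu ord0 j.
  by rewrite !mxE; field.
have oh : optimal c p g x h.
  split; first split => [j|l].
  - by rewrite hE addr_ge0// mulr_ge0// ?invr_ge0//; [case: fmu|case: fnu].
  - by rewrite !colour_sumD; case: fmu => _ ->; case: fnu => _ ->; field.
  - move=> k fk; rewrite /h !baryD nm !wdotD -muE => bk.
    have -> : wdot g mu + 2^-1 * (wdot g mu + -1 * wdot g mu) = wdot g mu by ring.
    apply: omu.2 => //; by rewrite bk scaleN1r addrN scaler0 addr0.
apply/eqP; rewrite -subr_eq0 -scaleN1r; apply/eqP.
apply: (good_jindep gg (optimal_good oh)); first exact: circB fmu fnu (esym nm).
apply/wsupp_sub0 => j; rewrite wsuppN0 hE => /eqP h0.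
have [/(_ j) mu0 _] := fmu; have [/(_ j) nu0 _] := fnu.
by rewrite !mxE; lra.
Qed.

Lemma face_measurable S x : lam.-cara.-measurable (face S x).
Proof.
have cb : continuous bary by exact: lincomb_continuous.
have cf : compact (face S x).
  apply: continuous_compact; last exact: feas_compact.
  exact: continuous_subspaceT.
have : closed (face S x) by apply: compact_closed => //; exact: norm_hausdorff.
move/closed_openC/open_caratheodory => /measurableC; rewrite setCK; exact.
Qed.

(** Independence makes the weight of a point unique within [S], so a point of the face lies in a
    smaller face exactly when its weight vanishes somewhere on [S]. *)
Lemma cell_face S x : jindep S ->
  cell S x = face S x `\` \bigcup_(j in [set j | j \in S]) face (S :\ j) x.
Proof.
move=> iS; apply/seteqP; split => [_ [mu [fmu muS] <-]|_ [[mu [fmu smu] <-] muN]].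
  subst S.
  split; first by exists mu.
  move=> [j /= jmu [nu [fnu snu]] nm].
  have mnu : mu = nu.
    apply/eqP; rewrite -subr_eq0 -scaleN1r; apply/eqP.
    apply: iS; first by apply: circB fmu fnu _.
    apply/wsupp_sub0 => k kmu; have /eqP muk : mu ord0 k == 0 by rewrite -wsuppN0.
    have /(wsupp_sub0 _ _)/(_ k) := snu; rewrite in_setD1 (negbTE kmu) andbF => nuk.
    by rewrite !mxE muk nuk// mulr0 addr0.
  by move: snu; rewrite mnu in jmu *; move=> /fintype.subsetP/(_ _ jmu); rewrite !inE eqxx.
exists mu => //; split => //; apply/eqP; rewrite finset.eqEsubset smu/=.
apply: contrapT => /negP/subsetPn[j jS jmu]; apply: muN; exists j => //.
exists mu => //; split => //; apply/fintype.subsetP => k kmu.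
rewrite in_setD1 (fintype.subsetP smu)// andbT.
by apply: contraNneq jmu => <-.
Qed.

Lemma cell_measurable S x : jindep S -> lam.-cara.-measurable (cell S x).
Proof.
move=> /cell_face ->; apply: measurableD; first exact: face_measurable.
by apply: fin_bigcup_measurable => // j _; exact: face_measurable.
Qed.

Lemma cell_lebesgue_vol_fin S x : lebesgue_vol (cell S x) \is a fin_num.
Proof.
apply: (@lebesgue_vol_bounded_fin _ _ _ (\sum_i \sum_j x (c j) * `|p j ord0 i|)).
move=> _ [mu [[mu0 cmu] _] <-] i.
have x0 j : 0 <= x (c j).
  by rewrite -cmu sumr_ge0.
rewrite (bigD1 i)//= -[leLHS]addr0 lerD//; last first.
  by apply: sumr_ge0 => k _; apply: sumr_ge0 => j _; rewrite mulr_ge0.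
rewrite summxE (le_trans (ler_norm_sum _ _ _))//; apply: ler_sum => j _.
rewrite mxE normrM ler_wpM2r// ger0_norm//.
by rewrite -cmu /colour_sum (bigD1 j)//= lerDl sumr_ge0.
Qed.

End Cells.

(** * Scaling of cells and the volume polynomial *)

Lemma row_free_completion {F : fieldType} {d m : nat} (A : 'M[F]_(d, m)) : row_free A ->
  exists (G : 'M[F]_m) (f : 'I_d -> 'I_m),
    [/\ G \in unitmx, injective f & forall i, row (f i) G = row i A].
Proof.
move=> fA; have dm : (d <= m)%N by rewrite -(eqP fA) rank_leq_col.
rewrite -(subnKC dm) in A fA *; move: (m - d)%N A fA => r A fA {dm}.
have rk : \rank A^C%MS = r by rewrite mxrank_compl (eqP fA) addKn.
exists (col_mx A (castmx (rk, erefl) (row_base A^C%MS))), (@lshift d r).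
split; [|exact: lshift_inj|by move=> i; rewrite rowKu].
rewrite -row_full_unit -sub1mx -addsmxE.
have : (1%:M <= A + A^C)%MS by rewrite sub1mx addsmx_compl_full.
move/submx_trans; apply; apply: addsmxS => //.
by rewrite eqmx_cast eq_row_base.
Qed.

Section CellScaling.
Context {R : realType} {n N : nat} {L : finType}.
Notation V := 'rV[R]_n.+1.
Notation W := 'rV[R]_N.
Notation lam := (@lebesgue_outer R n).
Variables (c : 'I_N -> L) (p : 'I_N -> V).
Implicit Types (x : L -> R) (mu nu u g : W) (S D : {set 'I_N}).

Notation feas := (feas c).
Notation bary := (bary p).
Notation jindep := (jindep c p).
Notation good := (good c p).
Notation cell := (cell c p).
Notation polytope := (polytope c p).

(** A linear relation [v] among the edges becomes a circulation supported in [S]: [v] gives the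
    weights of the other points, and each base point takes minus the sum over its colour. *)
Lemma jindep_edges_free S (b : L -> 'I_N) : jindep S ->
    (forall l, b l \in S) -> (forall l, c (b l) = l) ->
  row_free (\matrix_(i < #|[set j in S | j != b (c j)]|)
    (p (enum_val i) - p (b (c (enum_val i))))).
Proof.
set D := [set j in S | _] => iS bS cb; apply: inj_row_free => v vw0.
pose u0 : W := \row_j \sum_(i < #|D| | enum_val i == j) v ord0 i.
pose u : W := \row_j (u0 ord0 j - (j == b (c j))%:R * colour_sum c u0 (c j)).
have u0D j : j \notin D -> u0 ord0 j = 0.
  move=> jD; rewrite mxE big1// => i /eqP ij.
  by move: jD; rewrite -ij enum_valP.
have ub l : \sum_(j | c j == l) (j == b (c j))%:R * colour_sum c u0 (c j) = colour_sum c u0 l.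
  rewrite (bigD1 (b l)) ?cb//= eqxx mul1r big1 ?addr0// => j /andP[/eqP <- /negbTE ->].
  by rewrite mul0r.
have : u = 0.
  apply: iS; first split.
  - move=> l; rewrite /colour_sum; under eq_bigr do rewrite mxE.
    by rewrite sumrB ub subrr.
  - rewrite /bary; under eq_bigr do rewrite mxE scalerBl.
    rewrite sumrB.
    have -> : \sum_j ((j == b (c j))%:R * colour_sum c u0 (c j)) *: p j =
        \sum_j u0 ord0 j *: p (b (c j)).
      rewrite (partition_big c xpredT)//= [RHS](partition_big c xpredT)//=.
      apply: eq_bigr => l _; rewrite (bigD1 (b l)) ?cb//= eqxx mul1r big1.
        rewrite addr0 scaler_suml; apply: eq_bigr => j /eqP ->//.
      by move=> j /andP[/eqP <- /negbTE ->]; rewrite mul0r scale0r.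
    rewrite -sumrB -[RHS]vw0 mulmx_sum_row.
    under eq_bigr do rewrite -scalerBr mxE scaler_suml.
    rewrite (exchange_big_dep xpredT)//=; apply: eq_bigr => i _.
    by rewrite (big_pred1 (enum_val i)) ?rowK// => j; rewrite eq_sym.
  - apply/wsupp_sub0 => j jS; rewrite mxE u0D ?inE ?(negbTE jS)// sub0r.
    case: eqP => [jb|_]; last by rewrite mul0r oppr0.
    by move: jS; rewrite jb bS.
move=> u0E; apply/rowP => i; rewrite mxE.
have := congr1 (fun w : W => w ord0 (enum_val i)) u0E; rewrite !mxE.
have /[!inE]/andP[_ /negbTE ->] : enum_val i \in D := enum_valP i.
rewrite mul0r subr0 (big_pred1 i)// => k; exact: (inj_eq enum_val_inj).
Qed.

(** The linear part [T] multiplies every edge [p j - p (b (c j))] by [x (c j)],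
    so an affine map takes the cell of unit masses to the cell of masses [x];
    [D] is [S] without the base points [b l].  If the edges do not span the
    space, both cells are null and the formula still holds. *)
Lemma cell_scaling S : jindep S -> (forall l, exists2 j, j \in S & c j = l) ->
  exists D : {set 'I_N}, forall x, (forall l, 0 < x l) ->
    lebesgue_vol (cell S x) =
    ((\prod_(j in D) x (c j))%:E * lebesgue_vol (cell S (fun=> 1%R)))%E.
Proof.
move=> iS cS; have /choice[b bP] l : exists j, j \in S /\ c j = l.
  by have [j] := cS l; exists j.
have bS l : b l \in S by case: (bP l).
have cb l : c (b l) = l by case: (bP l).
have := jindep_edges_free iS bS cb; set D := [set j in S | _]; set A := \matrix_i _.
move=> /row_free_completion[G [f [Gu finj fG]]].
exists D => x x0.
(* Injectivity of [f] leaves at most one factor: the scaling of the edge in row [k] of [G], or 1 for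
   a row added by the completion. *)
pose d : V := \row_k \prod_(i < #|D| | f i == k) x (c (enum_val i)).
have d0 k : 0 < d ord0 k by rewrite mxE prodr_gt0.
have dE : \prod_k d ord0 k = \prod_(j in D) x (c j).
  rewrite [RHS]big_enum_val; under eq_bigr do rewrite mxE.
  by rewrite (exchange_big_dep xpredT)//=; apply: eq_bigr => i _;
  rewrite (big_pred1 (f i))// => k; rewrite eq_sym.
pose T := invmx G *m diag_mx d *m G.
have edgeT j : j \in S -> (p j - p (b (c j))) *m T = x (c j) *: (p j - p (b (c j))).
  move=> jS; have [->|jb] := eqVneq j (b (c j)); first by rewrite cb subrr mul0mx scaler0.
  have jD : j \in D by rewrite inE jS jb.
  pose i := enum_rank_in jD j.
  have ij : enum_val i = j by rewrite enum_rankK_in.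
  have rE : row (f i) G = p j - p (b (c j)) by rewrite fG rowK ij.
  rewrite -rE /T !mulmxA rowE -(mulmxA _ G) mulmxV// mulmx1.
  have -> : (delta_mx 0 (f i) : V) *m diag_mx d = x (c j) *: (delta_mx 0 (f i) : V).
    apply/rowP => k; rewrite mul_mx_diag !mxE/= mulrC.
    have [->|] := eqVneq k (f i); last by rewrite !mulr0.
    by rewrite !mulr1 (big_pred1 i) ?ij// => m; rewrite (inj_eq finj).
  by rewrite scalemxAl.
(* [T] is prescribed on the edges, not on the base points; [z] corrects these and does not depend on
   the weights, since each colour has mass 1. *)
pose z : V := \sum_l (x l *: p (b l) - p (b l) *m T).
pose sc mu : W := \row_j (x (c j) * mu ord0 j).
have baryT mu : feas (fun=> 1) mu -> wsupp mu = S -> bary (sc mu) = bary mu *m T + z.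
  move=> [mu0 cmu] smu.
  have -> : z = \sum_j mu ord0 j *: (x (c j) *: p (b (c j)) - p (b (c j)) *m T).
    rewrite (partition_big c xpredT)//=; apply: eq_bigr => l _.
    rewrite -[LHS]scale1r -(cmu l) scaler_suml.
    by apply: eq_bigr => j /eqP ->.
  rewrite /bary mulmx_suml -big_split/=; apply: eq_bigr => j _.
  have [jS|jS] := boolP (j \in S); last first.
    have := jS; rewrite -smu wsuppN0 => /eqP muj.
    by rewrite mxE muj mulr0 !scale0r mul0mx addr0.
  rewrite mxE -scalemxAl -scalerDr mulrC -scalerA; congr (_ *: _).
  have := edgeT _ jS; rewrite mulmxBl scalerBr => /eqP.
  by rewrite subr_eq => /eqP ->; rewrite addrACA subrr addr0 subrK.
have -> : cell S x = (fun y => y + z) @` (mulmxr T @` cell S (fun=> 1%R)).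
  rewrite !image_comp; apply/seteqP; split.
    move=> _ [mu [[mu0 cmu] smu] <-].
    pose nu : W := \row_j ((x (c j))^-1 * mu ord0 j).
    have nusc : sc nu = mu.
      by apply/rowP => j; rewrite !mxE mulVKf// gt_eqF.
    have fnu : feas (fun=> 1) nu.
      split=> [j|l]; first by rewrite mxE mulr_ge0// invr_ge0 ltW.
      rewrite /colour_sum (eq_bigr (fun j => (x l)^-1 * mu ord0 j)).
        by rewrite -mulr_sumr [X in _ * X]cmu mulVf// gt_eqF.
      by move=> j /eqP <-; rewrite mxE.
    have snu : wsupp nu = S.
      by rewrite -smu; apply/setP => j; rewrite !inE mxE mulf_eq0 invr_eq0 gt_eqF.
    by exists nu; [|rewrite -[in RHS]nusc baryT].
  move=> _ [mu [fmu smu] /= <-]; have [mu0 cmu] := fmu.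
  exists (sc mu); last by rewrite baryT.
  split; first split=> [j|l].
  - by rewrite mxE mulr_ge0// ltW.
  - rewrite /colour_sum (eq_bigr (fun j => x l * mu ord0 j)).
      by rewrite -mulr_sumr [X in _ * X]cmu mulr1.
    by move=> j /eqP <-; rewrite mxE.
  - by rewrite -smu; apply/setP => j; rewrite !inE mxE mulf_eq0 gt_eqF.
by rewrite lebesgue_vol_translate lebesgue_vol_conj_diag// dE.
Qed.

(** The volumes of the good cells add up, by disjointness and measurability, and each is a monomial
    times its value at unit masses. Supports that are not good get coefficient 0. *)
Lemma polytope_lebesgue_vol : exists (C : {set 'I_N} -> R) (D : {set 'I_N} -> {set 'I_N}),
  (forall S, 0 <= C S) /\ forall x, (forall l, 0 < x l) ->
    lebesgue_vol (polytope x) = (\sum_S C S * \prod_(j in D S) x (c j))%:E.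
Proof.
have [g gg] := generic_exists c p.
have /choice[CD CDP] S : exists CD : R * {set 'I_N}, 0 <= CD.1 /\
  forall x, (forall l, 0 < x l) -> (if `[< good g S >] then lebesgue_vol (cell S x) else 0%E) =
    (CD.1 * \prod_(j in CD.2) x (c j))%:E.
  case: asboolP => [gS|_]; last by exists (0, finset.set0) => /=; split => // x _; rewrite mul0r.
  have [cS|cS] := pselect (forall l, exists2 j, j \in S & c j = l); last first.
    (* Some colour has no point in [S] but positive mass, so the cell is empty. *)
    exists (0, finset.set0) => /=; split => // x x0; rewrite mul0r.
    suff -> : cell S x = set0 by rewrite lebesgue_vol0.
    apply/seteqP; split => // y [mu [[mu0 cmu] smu] _]; apply: cS => l.
    have := x0 l; rewrite -cmu => /lt0r_neq0.
    rewrite /colour_sum => cl0; apply: contrapT => H; move/eqP: cl0; apply.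
    apply: big1 => j /eqP cj; apply/eqP; rewrite -wsuppN0 smu; apply/negP => jS.
    by apply: H; exists j.
  have [D DP] := cell_scaling (good_jindep gg gS) cS.
  exists (fine (lebesgue_vol (cell S (fun=> 1%R))), D) => /=.
  split=> [|x x0]; first by rewrite fine_ge0// lebesgue_vol_ge0.
  by rewrite DP// mulrC EFinM fineK// cell_lebesgue_vol_fin.
exists (fun S => (CD S).1), (fun S => (CD S).2); split=> [S|x x0].
  by case: (CDP S).
rewrite (polytope_cells c p g x).
have mcell S : good g S -> lam.-cara.-measurable (cell S x).
  by move=> gS; apply: cell_measurable; exact: good_jindep gg gS.
have /= -> := @measure_fin_bigcup _ _ (caratheodory_type lam) lam _ (good g) (fun S => cell S x)
   finite_finset (trivIset_cells gg) mcell.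
rewrite fsbig_mkcond (@fsbig_fwiden _ _ _ _ (index_enum {set 'I_N})).
- by rewrite -sumEFin; apply: eq_bigr => T _; rewrite -(CDP T).2// patchE.
- by move=> T _ /=; exact: mem_index_enum.
- exact: index_enum_uniq.
- by rewrite setDT; exact: sub0set.
Qed.

End CellScaling.

(** * Supermodularity of monomials *)

(** With the factors grouped by [a], the sum is the expansion of the product over [i] of
    [P hi i - P lo i], whose factors are nonnegative. *)
Lemma alternating_prod_ge0 {R : realDomainType} {N m : nat} (a : 'I_N -> 'I_m)
    (D : {set 'I_N}) (lo hi : 'I_N -> R) :
  (forall j, 0 <= lo j <= hi j) ->
  0 <= \sum_(I : {set 'I_m}) (-1) ^+ (m - #|I|) *
    \prod_(j in D) (if a j \in I then hi j else lo j).
Proof.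
move=> lohi.
pose P (f : 'I_N -> R) i := \prod_(j in D | a j == i) f j.
suff -> : \sum_(I : {set 'I_m}) (-1) ^+ (m - #|I|) *
    \prod_(j in D) (if a j \in I then hi j else lo j) =
    \prod_i (P hi i + - P lo i).
  apply: prodr_ge0 => i _; rewrite subr_ge0.
  by apply: ler_prod => j _; exact: lohi.
rewrite bigA_distr; apply: eq_bigr => I _.
have -> : (m - #|I|)%N = #|~: I|%SET by rewrite [RHS]finset.cardsCs finset.setCK card_ord.
rewrite -prodr_const (partition_big a xpredT)//= [X in _ * X](bigID (mem I))/=.
rewrite [RHS](bigID (mem I))/= mulrCA; congr (_ * _).
  apply: eq_bigr => i iI; rewrite iI; apply: eq_bigr => j /andP[_ /eqP ->].
  by rewrite iI.
rewrite (eq_bigl (fun i => i \notin I)) => [|i]; last by rewrite inE.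
rewrite -big_split/=; apply: eq_bigr => i iI; rewrite (negbTE iI) mulN1r; congr (- _).
by apply: eq_bigr => j /andP[_ /eqP ->]; rewrite (negbTE iI).
Qed.

Section JoinOwner.
Context {R : realType} {k m : nat}.
Variables (x0 : 'I_k -> R) (xs : 'I_m -> 'I_k -> R).
Hypotheses (m0 : (0 < m)%N) (x0_ge0 : nonneg_vec x0) (xs_ge0 : forall i, nonneg_vec (xs i))
  (xs_disj : forall i j : 'I_m, i != j -> forall l, Num.min (xs i l) (xs j l) = 0).

(** By disjointness at most one [xs i] is positive at a coordinate [l], and this [i] owns [l]. A
    coordinate without one gets an arbitrary owner, which exists as [0 < m]. *)
Lemma join_over_owner : exists a : 'I_k -> 'I_m, forall I l,
  join_over x0 xs I l = if a l \in I then Num.max (x0 l) (xs (a l) l) else x0 l.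
Proof.
have /choice[a aP] l : exists i : 'I_m, forall j, j != i -> xs j l = 0.
  have [[i xi]|none] := pselect (exists i, 0 < xs i l).
    exists i => j /xs_disj/(_ l); rewrite minEle; case: ifP => //.
    by move=> _ xi0; rewrite xi0 ltxx in xi.
  exists (Ordinal m0) => j _; apply/eqP; rewrite eq_le xs_ge0 andbT leNgt.
  by apply/negP => xj; apply: none; exists j.
exists a => I l; rewrite /join_over; case: ifPn => aI; last first.
  rewrite max_l//; apply: bigmax_le => // i iI.
  by rewrite (aP l) ?x0_ge0//; apply: contraNneq aI => <-.
congr Num.max; apply/eqP; rewrite eq_le; apply/andP; split.
  apply: bigmax_le; first exact: xs_ge0.
  move=> i iI; have [->//|/aP ->] := eqVneq i (a l); exact: xs_ge0.
exact: le_bigmax_cond.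
Qed.

End JoinOwner.

Lemma join_over_ge0 {R : realType} {k m : nat} (x0 : 'I_k -> R) (xs : 'I_m -> 'I_k -> R) I l :
  nonneg_vec x0 -> 0 <= join_over x0 xs I l.
Proof. by move=> x00; rewrite le_max x00. Qed.

(** The weights are not normalised, so the total may be 0; any point of the nonempty [B] then
    serves. Otherwise convexity is applied with each weight divided by the running total. *)
Lemma convex_set_sum {R : realType} {n N : nat} (B : set 'rV[R]_n) (P : pred 'I_N)
    (w : 'I_N -> R) (p : 'I_N -> 'rV[R]_n) :
    B !=set0 -> convex_set (B : set (convex_lmodType 'rV[R]_n)) ->
    (forall j, 0 <= w j) -> (forall j, P j -> B (p j)) ->
  exists2 q, B q & \sum_(j | P j) w j *: p j = (\sum_(j | P j) w j) *: q.
Proof.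
move=> [b0 Bb0] cB w0 Bp.
suff : exists q, [/\ B q, 0 <= \sum_(j | P j) w j &
    \sum_(j | P j) w j *: p j = (\sum_(j | P j) w j) *: q].
  by move=> [q [? ? ?]]; exists q.
elim/big_rec2 : _ => [|j s S Pj [q [Bq S0 ->]]]; first by exists b0; split; rewrite ?scale0r.
have [t0|t0] := eqVneq (w j + S) 0.
  have wj : w j = 0 by have := w0 j; lra.
  have S00 : S = 0 by lra.
  by exists b0; split => //; rewrite wj S00 addr0// !scale0r addr0.
have tp : 0 < w j + S by rewrite lt_neqAle eq_sym t0 addr_ge0.
have l0 : 0 <= w j / (w j + S) by rewrite divr_ge0// ltW.
have l1 : w j / (w j + S) <= 1 by rewrite ler_pdivrMr// mul1r lerDl.
have := cB (p j) q (Itv01 l0 l1) (mem_set (Bp _ Pj)) (mem_set Bq).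
rewrite inE => Bc; exists (conv (Itv01 l0 l1) (p j : convex_lmodType 'rV[R]_n) q).
split => //; first exact: ltW.
rewrite scalerDr !scalerA /=; congr (_ *: _ + _ *: _); first by rewrite mulrC divfK.
by rewrite -[X in _ = _ * X]/(1 - w j / (w j + S)); field.
Qed.

(** * Approximation by polytopes *)

(** The product of the bodies is compact by Tychonoff, and the combination is its continuous
    image. *)
Lemma compact_minkowski_comb {R : realType} {n k : nat} (x : 'I_k -> R)
    (B : 'I_k -> set 'rV[R]_n) :
  (forall l, compact (B l)) -> compact (minkowski_comb x B).
Proof.
move=> cB; have := tychonoff cB; set F := [set b | _] => cF.
have -> : minkowski_comb x B = (fun b : forall l : 'I_k, 'rV[R]_n => \sum_l x l *: b l) @` F.
  by apply/seteqP; split => [_ [b [Bb ->]]|_ [b Bb <-]]; exists b.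
apply: continuous_compact cF; apply: continuous_subspaceT.
apply: (continuous_big add_continuous) => l _ b.
have bl := @proj_continuous _ (fun=> 'rV[R]_n) l b.
exact: (continuous_comp bl (@scaler_continuous _ _ (x l) (b l))).
Qed.

Lemma compact_open_thicken {R : realType} {n : nat} (K U : set 'rV[R]_n) :
  compact K -> open U -> K `<=` U ->
  exists2 d : R, 0 < d & forall y, K y -> ball y d `<=` U.
Proof.
move=> /compact_near_coveringP cK oU KU.
have : \forall d \near 0^'+, K `<=` (fun y => ball y d `<=` U).
  apply: cK => y /KU Uy; have /nbhs_ballP[e /= e0 yeU] : nbhs y U by exact: open_nbhs_nbhs.
  have e20 : 0 < e / 2 by rewrite divr_gt0.
  exists (ball y (e / 2), [set d : R | d < e / 2]) => /=.
    by split; [exact: nbhsx_ballx|exact: nbhs_right_lt].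
  move=> [z d] /= [yz de] w zw; apply: yeU; rewrite (splitr e).
  by apply: (ball_triangle yz); apply: le_ball zw; exact: ltW.
move=> dK; have /filter_ex[d [d0 dU]] : \forall d \near (0 : R)^'+,
    0 < d /\ K `<=` (fun y => ball y d `<=` U).
  by near=> d; split; near: d => //; exact: nbhs_right_gt.
by exists d.
Unshelve. all: by end_near. Qed.

Lemma compact_net {R : realType} {n : nat} (B : set 'rV[R]_n) (e : R) : compact B -> 0 < e ->
  exists s : seq 'rV[R]_n, (forall v, v \in s -> B v) /\
    forall b, B b -> exists2 v, v \in s & forall i, `|b ord0 i - v ord0 i| <= e.
Proof.
rewrite compact_cover => cB e0.
have [||D DB Bcov] := cB _ B (fun v => ball v e).
- by move=> v _; exact: ball_open.
- by move=> b Bb; exists b => //; exact: ballxx.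
exists (finmap.enum_fset D); split=> [v vD|b Bb].
  by have := DB v vD; rewrite inE.
have [v vD [_ /(_ ord0) vb]] := Bcov _ Bb; exists v => // i.
by rewrite distrC; exact: ltW (vb i).
Qed.

Lemma compact_coord_bound {R : realType} {n : nat} (B : set 'rV[R]_n) : compact B ->
  exists M : R, forall b, B b -> forall i, `|b ord0 i| <= M.
Proof.
move=> /compact_bounded[M [_ BM]]; exists (M + 1) => b /(BM (M + 1)) => /(_ _)/le_trans bM i.
apply: (@le_trans _ _ `|b|); last by apply: bM; rewrite ?ltrDl.
rewrite [leRHS]/Num.norm/= mx_normrE.
exact: (@le_bigmax _ _ _ 0 (fun ij : 'I_1 * 'I_n => `|b ij.1 ij.2|) (ord0, i)).
Qed.

Section PolytopeMembers.
Context {R : realType} {n N : nat} {L : finType}.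
Variables (c : 'I_N -> L) (p : 'I_N -> 'rV[R]_n.+1).

Lemma polytopeD x x' y y' : polytope c p x y -> polytope c p x' y' ->
  polytope c p (x \+ x') (y + y').
Proof.
move=> [mu [mu0 cmu] <-] [nu [nu0 cnu] <-].
exists (mu + 1 *: nu); last by rewrite baryD scale1r.
split=> [j|l]; first by rewrite !mxE mul1r addr_ge0.
by rewrite colour_sumD cmu cnu mul1r.
Qed.

Lemma polytope_vertex (t : R) j : 0 <= t ->
  polytope c p (fun l => if l == c j then t else 0) (t *: p j).
Proof.
move=> t0; exists (t *: delta_mx 0 j).
  split=> [i|l]; first by rewrite !mxE mulr_ge0.
  case: eqP => [->|lj].
    rewrite /colour_sum (bigD1 j)//= !mxE !eqxx mulr1 big1 ?addr0// => i /andP[_ ij].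
    by rewrite !mxE (negbTE ij) andbF mulr0.
  rewrite /colour_sum big1// => i /eqP ci; rewrite !mxE.
  by have [ij|_] := eqVneq i j; [case: lj; rewrite -ci ij|rewrite andbF mulr0].
rewrite /bary (bigD1 j)//= !mxE !eqxx mulr1 big1 ?addr0// => i ij.
by rewrite !mxE (negbTE ij) andbF mulr0 scale0r.
Qed.

Lemma polytope_sum (I : Type) (r : seq I) (x : I -> L -> R) (y : I -> 'rV[R]_n.+1) :
  (forall i, polytope c p (x i) (y i)) ->
  polytope c p (fun l => \sum_(i <- r) x i l) (\sum_(i <- r) y i).
Proof.
move=> xy; elim: r => [|i r IH].
  rewrite big_nil; exists 0; last by rewrite /bary big1// => j _; rewrite mxE scale0r.
  split=> [j|l]; first by rewrite mxE.
  by rewrite big_nil /colour_sum big1// => j _; rewrite mxE.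
rewrite big_cons; have := polytopeD (xy i) IH.
by congr (polytope c p _ _); apply/funext => l /=; rewrite big_cons.
Qed.

End PolytopeMembers.

Section Approximation.
Context {R : realType} {n k : nat}.
Notation V := 'rV[R]_n.+1.
Variable B : 'I_k -> set V.
Hypotheses (cB : forall l, compact (B l)) (B0 : forall l, B l !=set0)
  (vB : forall l, convex_set (B l : set (convex_lmodType V))).

(** Colour [ord0] is the cross-polytope, colour [lift ord0 l] the body [B l]. *)
Definition net_weights (x : 'I_k -> R) (e s : R) (o : 'I_k.+1) : R :=
  if unlift ord0 o is Some l then x l + e else s.

(** The points [p (q ib)] are the vertices of a cross-polytope large enough to contain the unit
    cube, so a multiple of it absorbs any error bounded in each coordinate. *)
Lemma coloured_net (e : R) : 0 < e ->
  exists (J : finType) (c : J -> 'I_k.+1) (p : J -> V) (q : 'I_n.+1 * bool -> J),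
  [/\ forall j l, c j = lift ord0 l -> B l (p j),
      forall l b, B l b -> exists j, c j = lift ord0 l /\
        forall i, `|b ord0 i - p j ord0 i| <= e,
      forall j, c j = ord0 -> forall i, `|p j ord0 i| <= n.+1%:R,
      forall ib, c (q ib) = ord0 &
      forall ib, p (q ib) = ((-1) ^+ ib.2 * n.+1%:R) *: delta_mx 0 ib.1].
Proof.
move=> e0; have /choice[s sP] l := compact_net (@cB l) e0.
pose J := ({l : 'I_k & 'I_(size (s l))} + 'I_n.+1 * bool)%type.
pose c (j : J) : 'I_k.+1 := if j is inl (existT l _) then lift ord0 l else ord0.
pose p (j : J) : V := match j with
  | inl (existT l a) => nth 0 (s l) a
  | inr ib => ((-1) ^+ ib.2 * n.+1%:R) *: delta_mx 0 ib.1
  end.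
exists J, c, p, inr; split => //.
- move=> [[l a]|//] l' /= /lift_inj <-; apply: (sP l).1; exact: mem_nth.
- move=> l b /(sP l).2[v vs bv]; have vi : (index v (s l) < size (s l))%N by rewrite index_mem.
  exists (inl (existT _ l (Ordinal vi))); split => // i.
  by rewrite /= nth_index.
- move=> [[l a]|[i b]] //= _ i'; rewrite !mxE eqxx/= normrM normrMsign.
  rewrite [`|n.+1%:R|]ger0_norm// ler_piMr//.
  by case: eqP => _; rewrite ?normr1 ?normr0.
Qed.

Lemma polytope_approx (X e : R) : 0 <= X -> 0 < e ->
  exists (N : nat) (c : 'I_N -> 'I_k.+1) (p : 'I_N -> V) (d s : R),
  [/\ 0 < d, 0 < s & forall x, nonneg_vec x -> \sum_l x l <= X ->
    minkowski_comb x B `<=` polytope c p (net_weights x d s) /\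
    forall y, polytope c p (net_weights x d s) y ->
      exists2 z, minkowski_comb x B z & ball z e y].
Proof.
move=> X0 e0; have /choice[M' M'P] l := compact_coord_bound (@cB l).
pose M := \sum_l `|M' l|.
have MP l b i : B l b -> `|b ord0 i| <= M.
  move=> /M'P/(_ i)/le_trans; apply; rewrite (le_trans (ler_norm _))//.
  by rewrite /M (bigD1 l)//= lerDl sumr_ge0.
have M0 : 0 <= M by apply: sumr_ge0.
pose n1 : R := n.+1%:R; have n10 : 0 < n1 by rewrite ltr0n.
(* [d * C] will bound each coordinate of the net error: fineness [d] costs at most [d * X],
   enlarging the coefficients by [d] at most [d * (k * M)]. This is the mass [s] of the
   cross-polytope. *)
pose C := X + k%:R * M + 1.
have kM0 : 0 <= k%:R * M by rewrite mulr_ge0.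
have C0 : 0 < C by rewrite ltr_wpDl ?addr_ge0.
(* Conversely, [d * K] will exceed the distance from a point of the polytope to the combination:
   [s * n1] comes from the cross-polytope, [d * (k * M)] from the enlarged coefficients. *)
pose K := k%:R * M + C * n1 + 1.
have CK : k%:R * M + C * n1 < K by rewrite /K ltrDl.
have K0 : 0 < K by rewrite (le_lt_trans _ CK)// addr_ge0// mulr_ge0// ltW.
have [d d0 dK] : exists2 d, 0 < d & d * K = e.
  by exists (e / K); rewrite ?divr_gt0// divfK// gt_eqF.
have [s sE] : exists s, s = d * C by exists (d * C).
have s0 : 0 < s by rewrite sE mulr_gt0.
have [J [c [p [q [cB' netB c0B cq pq]]]]] := coloured_net d0.
pose c' (j : 'I_#|J|) := c (enum_val j); pose p' (j : 'I_#|J|) := p (enum_val j).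
exists #|J|, c', p', d, s; split => // x x0 xX.
have vert t j : 0 <= t -> polytope c' p' (fun l => if l == c j then t else 0) (t *: p j).
  by move=> t0; have := polytope_vertex c' p' (enum_rank j) t0; rewrite /c' /p' enum_rankK.
split.
- move=> _ [b [Bb ->]]; have /choice[j jP] l := netB l _ (Bb l).
  have xd l : 0 <= x l + d by rewrite addr_ge0// ltW.
  (* The error [r] of the net is absorbed by the cross-polytope. *)
  pose r : V := \sum_l x l *: b l - \sum_l (x l + d) *: p (j l).
  have rs i : `|r ord0 i| <= s.
    have -> : r ord0 i = \sum_l (x l * (b l ord0 i - p (j l) ord0 i) - d * p (j l) ord0 i).
      rewrite !mxE !summxE -sumrB; apply: eq_bigr => l _; rewrite !mxE; ring.
    apply: (le_trans (ler_norm_sum _ _ _)).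
    apply: (@le_trans _ _ (\sum_l (x l * d + d * M))).
      apply: ler_sum => l _; apply: le_trans (ler_normB _ _) _.
      rewrite !normrM (ger0_norm (x0 l)) (ger0_norm (ltW d0)).
      apply: lerD; apply: ler_wpM2l; rewrite ?(ltW d0) ?x0//; first by have [_] := jP l.
      by apply: (MP l); apply: cB'; have [] := jP l.
    rewrite big_split/= -mulr_suml sumr_const card_ord -mulr_natl mulrCA mulrC -mulrDr.
    by rewrite sE /C ler_pM2l// -addrA lerD// lerDl.
  (* Opposite vertices in direction [i] get weights whose difference produces [r ord0 i] and whose
     sum is [s / n1], so that the total mass is exactly [s]. *)
  pose w (ib : 'I_n.+1 * bool) := (s + (-1) ^+ ib.2 * r ord0 ib.1) / (n1 * 2).
  have w0 ib : 0 <= w ib.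
    rewrite divr_ge0// ?mulr_ge0 ?(ltW n10)// -lerBlDl sub0r.
    by have := rs ib.1; rewrite -[`|_|](normrMsign ib.2) ler_norml => /andP[].
  have rw : r = \sum_ib w ib *: p (q ib).
    apply/rowP => i; rewrite summxE.
    under eq_bigr do rewrite pq !mxE/=.
    rewrite -(pair_bigA _ (fun a b => w (a, b) * ((-1) ^+ b * n.+1%:R * (i == a)%:R)))/=.
    rewrite (bigD1 i)//= [X in _ + X]big1 ?addr0 => [|a ai]; last first.
      by rewrite big1// => b0 _; rewrite eq_sym (negbTE ai) !mulr0.
    rewrite big_bool /w/= eqxx !mxE expr1 expr0 -/n1 (_ : true%:R = 1 :> R)//; field.
    by rewrite gt_eqF.
  have -> : \sum_l x l *: b l = \sum_l (x l + d) *: p (j l) + \sum_ib w ib *: p (q ib).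
    by rewrite -rw addrC subrK.
  have := polytopeD (polytope_sum (index_enum _) (fun l => vert _ (j l) (xd l)))
    (polytope_sum (index_enum _) (fun ib => vert _ (q ib) (w0 ib))).
  congr (polytope _ _ _ _); apply/funext => o /=; rewrite /net_weights.
  case: unliftP => [l|] -> /=.
    rewrite (bigD1 l)//= (jP l).1 eqxx big1 ?big1 ?addr0// => [ib _|a al].
      by rewrite cq.
    by rewrite (jP a).1 (inj_eq lift_inj) eq_sym (negbTE al).
  rewrite big1 ?add0r => [|l _]; last by rewrite (jP l).1.
  rewrite (eq_bigr w) => [|ib _]; last by rewrite cq eqxx.
  rewrite -(pair_bigA _ (fun a b => w (a, b)))/=.
  rewrite (eq_bigr (fun=> s / n1)) => [|i _].
    by rewrite sumr_const card_ord -mulr_natr divfK// gt_eqF.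
  by rewrite big_bool /w/= expr1 expr0; field; rewrite gt_eqF.
- move=> _ [mu [mu0 cmu] <-].
  (* By convexity, the points of each colour combine to a multiple of one point [v l] of the
     body. *)
  have /choice[v vP] l : exists v, B l v /\
      \sum_(j | c' j == lift ord0 l) mu ord0 j *: p' j = (x l + d) *: v.
    have [|v Bv ->] := @convex_set_sum _ _ _ (B l) (fun j => c' j == lift ord0 l)
      (fun j => mu ord0 j) p' (B0 l) (@vB l) mu0.
      by move=> j /eqP; exact: cB'.
    exists v; split => //; rewrite [X in X *: _]cmu /net_weights liftK//.
  exists (\sum_l x l *: v l); first by exists v; split => // l; case: (vP l).
  split => // i0 i; rewrite ord1 {i0} /ball/= distrC.
  have -> : bary p' mu ord0 i - (\sum_l x l *: v l) ord0 i =
      \sum_(j | c' j == ord0) mu ord0 j * p' j ord0 i + \sum_l d * v l ord0 i.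
    rewrite /bary (partition_big c' xpredT)//= big_ord_recl.
    have -> : \sum_(l < k) \sum_(j | c' j == lift ord0 l) mu ord0 j *: p' j =
        \sum_l x l *: v l + \sum_l d *: v l.
      by rewrite -big_split/=; apply: eq_bigr => l _; rewrite -scalerDl; case: (vP l).
    rewrite !mxE addrA addrAC addrK !summxE.
    by congr (_ + _); apply: eq_bigr => j _; rewrite mxE.
  apply: (@le_lt_trans _ _ (s * n1 + k%:R * (d * M))); last first.
    by rewrite -dK sE mulrCA -mulrA -mulrDr ltr_pM2l// addrC.
  apply: le_trans (ler_normD _ _) _; apply: lerD.
    have -> : s = colour_sum c' mu ord0 by rewrite cmu /net_weights unlift_none.
    rewrite mulr_suml; apply: le_trans (ler_norm_sum _ _ _) _; apply: ler_sum => j /eqP cj.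
    by rewrite normrM ger0_norm// ler_wpM2l// c0B.
  rewrite -[k in k%:R]card_ord mulr_natl -sumr_const.
  apply: le_trans (ler_norm_sum _ _ _) _; apply: ler_sum => l _.
  rewrite normrM gtr0_norm// ler_pM2l//; apply: (MP l); by case: (vP l).
Qed.
End Approximation.

(** * Supermodularity of the volume function *)

Lemma m_supermodular_cst {R : realType} {k m : nat} (f : ('I_k -> R) -> R) :
  (0 < m)%N -> (forall x, 0 <= f x) -> (forall x y, f x = f y) -> m_supermodular m f.
Proof.
move=> m0 f0 fc x0 xs _ _ _.
rewrite (eq_bigr (fun I : {set 'I_m} => (-1) ^+ (m - #|I|) * f x0)) => [|I _]; last first.
  by rewrite (fc _ x0).
rewrite -mulr_suml mulr_ge0//.
(* The sum of the signs is an alternating sum of empty products. *)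
have := @alternating_prod_ge0 R 0 m (fun=> Ordinal m0) finset.set0 (fun=> 0) (fun=> 0).
have -> // : \sum_(I : {set 'I_m}) (-1) ^+ (m - #|I|) *
    \prod_(j in finset.set0 : {set 'I_0}) (if Ordinal m0 \in I then 0 else 0) =
    \sum_(I : {set 'I_m}) (-1) ^+ (m - #|I|) :> R.
  by apply: eq_bigr => I _; rewrite finset.big_set0 mulr1.
by apply=> j; rewrite lexx.
Qed.

Lemma mixed_vol_fun_ge0 {R : realType} {n k : nat} (B : 'I_k -> set 'rV[R]_n) x :
  0 <= mixed_vol_fun B x.
Proof. by rewrite fine_ge0// lebesgue_vol_ge0. Qed.

Section Supermodular.
Context {R : realType} {n k m : nat}.
Notation V := 'rV[R]_n.+1.
Variable B : 'I_k -> set V.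
Hypotheses (cB : forall l, compact (B l)) (B0 : forall l, B l !=set0)
  (vB : forall l, convex_set (B l : set (convex_lmodType V))) (m0 : (0 < m)%N).

(** One choice of points and margins serves all [x i], so that the alternating sum can be evaluated
    on a single polynomial. Compactness leaves room [e i] between each combination and an open set
    of nearly the same volume; the least [e i], capped at 1, is the precision. *)
Lemma mixed_vol_fun_approx (I : finType) (x : I -> 'I_k -> R) (h : R) :
    (forall i, nonneg_vec (x i)) -> 0 < h ->
  exists (N : nat) (c : 'I_N -> 'I_k.+1) (p : 'I_N -> V) (d s : R),
  [/\ 0 < d, 0 < s & forall i,
    mixed_vol_fun B (x i) <= fine (lebesgue_vol (polytope c p (net_weights (x i) d s)))
      <= mixed_vol_fun B (x i) + h].
Proof.
move=> x_ge0 h0.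
have cK i : compact (minkowski_comb (x i) B) by exact: compact_minkowski_comb.
have /choice[U UP] i := lebesgue_vol_open_cover (minkowski_comb (x i) B) h0.
have /choice[e eP] i : exists e : R, 0 < e /\
    forall y, minkowski_comb (x i) B y -> ball y e `<=` U i.
  have [oU KU _] := UP i; have [e e0 eU] := compact_open_thicken (@cK i) oU KU.
  by exists e.
pose X := \sum_i \sum_l x i l.
have x0 i : 0 <= \sum_l x i l by apply: sumr_ge0 => l _; exact: x_ge0.
have X0 : 0 <= X by apply: sumr_ge0.
pose e' := \big[Num.min/1]_i e i.
have e'0 : 0 < e' by apply: lt_bigmin => // i _; case: (eP i).
have [N [c [p [d [s [d0 s0 PP]]]]]] := polytope_approx cB B0 vB X0 e'0.
exists N, c, p, d, s; split => // i.
have xX : \sum_l x i l <= X by rewrite /X (bigD1 i)//= lerDl sumr_ge0.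
have [KP PK] := PP _ (x_ge0 i) xX.
have PU : polytope c p (net_weights (x i) d s) `<=` U i.
  move=> y /PK[z Kz zy]; apply: ((eP i).2 z Kz); apply: le_ball zy.
  exact: bigmin_le.
have [_ _ UK] := UP i.
have Kfin : lebesgue_vol (minkowski_comb (x i) B) \is a fin_num.
  by have [M MP] := compact_coord_bound (@cK i); exact: lebesgue_vol_bounded_fin MP.
have leP := le_trans (le_lebesgue_vol PU) UK.
have Pfin : lebesgue_vol (polytope c p (net_weights (x i) d s)) \is a fin_num.
  rewrite ge0_fin_numE ?lebesgue_vol_ge0// (le_lt_trans leP)//.
  by rewrite -(fineK Kfin) -EFinD ltry.
apply/andP; split; first by apply: fine_le => //; exact: le_lebesgue_vol.
by rewrite -lee_fin EFinD !fineK.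
Qed.

Lemma mixed_vol_fun_supermodular : m_supermodular m (mixed_vol_fun B).
Proof.
move=> x0 xs x0_ge0 xs_ge0 xs_disj.
pose J I := join_over x0 xs I.
(* Each of the [#|{set 'I_m}|] terms may err by [h'], hence the whole sum by [h]. *)
apply/ler_addgt0Pr => h h0; pose h' := h / #|{set 'I_m}|%:R.
have card0 : 0 < #|{set 'I_m}|%:R :> R.
  by rewrite ltr0n; apply/card_gt0P; exists finset.set0.
have h'0 : 0 < h' by rewrite divr_gt0.
have J0 I : nonneg_vec (J I) by move=> l; exact: join_over_ge0.
have [N [c [p [d [s [d0 s0 approx]]]]]] := mixed_vol_fun_approx J0 h'0.
have [C [D [C0 volE]]] := polytope_lebesgue_vol c p.
have [a aE] := join_over_owner m0 x0_ge0 xs_ge0 xs_disj.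
pose P I : R := fine (lebesgue_vol (polytope c p (net_weights (J I) d s))).
have w0 I o : 0 < net_weights (J I) d s o.
  by rewrite /net_weights; case: unlift => [l|]//; rewrite ltr_wpDl// J0.
have P0 : 0 <= \sum_(I : {set 'I_m}) (-1) ^+ (m - #|I|) * P I.
  rewrite (eq_bigr (fun I : {set 'I_m} => \sum_S C S *
      ((-1) ^+ (m - #|I|) * \prod_(j in D S) net_weights (J I) d s (c j)))) => [|I _].
    rewrite exchange_big/=; apply: sumr_ge0 => S _; rewrite -mulr_sumr mulr_ge0//.
    (* The cross-polytope has the same mass [s] for every [I]: its owner is arbitrary and its values
       of [lo] and [hi] coincide. *)
    pose own o := if unlift ord0 o is Some l then a l else Ordinal m0.
    pose lo o := if unlift ord0 o is Some l then x0 l + d else s.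
    pose hi o := if unlift ord0 o is Some l then Num.max (x0 l) (xs (a l) l) + d else s.
    rewrite (eq_bigr (fun I : {set 'I_m} => (-1) ^+ (m - #|I|) *
        \prod_(j in D S) (if own (c j) \in I then hi (c j) else lo (c j)))) => [|I _].
      apply: (@alternating_prod_ge0 R N m (own \o c) _ (lo \o c) (hi \o c)) => j /=.
      rewrite /lo /hi; case: unlift => [l|]; last by rewrite lexx ltW.
      by rewrite lerD2r le_max lexx addr_ge0// ltW.
    congr (_ * _); apply: eq_bigr => j _; rewrite /net_weights /own /lo /hi.
    case: unlift => [l|]; last by rewrite if_same.
    by rewrite /J aE; case: ifP.
  rewrite /P volE//= mulr_sumr; apply: eq_bigr => S _; rewrite mulrCA//.
apply: le_trans P0 _; rewrite -lerBlDl -sumrB.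
have -> : h = \sum_(I : {set 'I_m}) h'.
  by rewrite sumr_const -mulr_natr divfK// gt_eqF.
apply: ler_sum => I _; rewrite -mulrBr.
(* A term with positive sign uses the upper bound on the approximation, one with negative sign the
   lower bound. *)
have /andP[l1 l2] := approx I.
rewrite -signr_odd; case: (odd _); rewrite ?expr1 ?expr0 ?mulN1r ?mul1r /P; lra.
Qed.

End Supermodular.

Theorem theorem3p6 (R : realType) (n k : nat) (B : 'I_k -> set 'rV[R]_n) :
  (forall i, compact (B i)) ->
  (forall i, convex_set (B i : set (convex_lmodType 'rV[R]_n))) ->
  forall m : nat, (0 < m)%N -> m_supermodular m (mixed_vol_fun B).
Proof.
move=> cB vB m m0.
have [B0|] := pselect (forall l, B l !=set0); last first.
  (* An empty body makes every combination empty, even with coefficient 0, so the function is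
     constant. *)
  move=> /existsNP[l /set0P/negP/negPn/eqP Bl0].
  apply: m_supermodular_cst => // [x|x y]; first exact: mixed_vol_fun_ge0.
  suff E z : minkowski_comb z B = set0 by rewrite /mixed_vol_fun !E.
  by apply/seteqP; split => // w [b [/(_ l)]]; rewrite Bl0.
case: n B cB vB B0 => [|n'] B' cB vB B0; last exact: mixed_vol_fun_supermodular.
(* In dimension 0 every combination is the whole space, so the function is again constant. *)
apply: m_supermodular_cst => // [x|x y]; first exact: mixed_vol_fun_ge0.
suff E z : minkowski_comb z B' = [set: 'rV[R]_0] by rewrite /mixed_vol_fun !E.
apply/seteqP; split => // w _; have /choice[b Bb] l : exists v, B' l v by exact: B0.
by exists b; split => //; apply/rowP; case.
Qed.
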